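(* Let $d$ be a positive integer and let $k_d=\max\{k\in\mathbb N: k(k+1)/2\le d\}$. Then $\mathcal S_d=\mathcal P_d$ if and only if for every $A\in\mathcal A_{d,k_d}$ there exists a $k_d$-dimensional random vector $V$ with mean vector $0$ and covariance matrix $I_{k_d}$ such that the marginal distributions of $AV$ (i.e. the distributions of its $d$ components) are all $\mathrm U[-\sqrt 3,\sqrt 3]$.
   Context: All random variables and random vectors are defined on a fixed atomless probability space. Vectors are treated as column vectors, $I_k$ is the $k\times k$ identity matrix, and $\mathrm U[a,b]$ is the uniform distribution on $[a,b]$. For random variables $X_1,X_2$ with continuous distribution functions $F_1,F_2$, Spearman's rho is $\rho^S(X_1,X_2)=\rho^P(F_1(X_1),F_2(X_2))=12\,\mathbb E[F_1(X_1)F_2(X_2)]-3$, where $\rho^P$ is the Pearson (linear) correlation coefficient. For a $d$-dimensional random vector $X=(X_1,\dots,X_d)$ with continuous marginal distributions, its Spearman's rho matrix is the $d\times d$ matrix with entries $\rho^S(X_i,X_j)$, $i,j=1,\dots,d$. A $d\times d$ matrix is called a Spearman's rho matrix if it is the Spearman's rho matrix of some $d$-dimensional random vector with continuous marginal distributions. $\mathcal S_d$ denotes the set of all $d\times d$ Spearman's rho matrices. $\mathcal P_d$ denotes the set of all $d\times d$ real symmetric positive semi-definite matrices whose diagonal entries are all equal to $1$. $\mathcal A_{d,k}$ denotes the set of $d\times k$ real matrices each of whose rows is a unit vector (Euclidean norm $1$) in $\mathbb R^k$; no rank condition is imposed. *)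

(* Defs.v *)
From HB Require Import structures.
From mathcomp Require Import all_boot all_order all_algebra zify.
From mathcomp Require Import all_classical all_reals all_analysis measurable_realfun.

Set Implicit Arguments.
Unset Strict Implicit.
Unset Printing Implicit Defensive.

Import Order.TTheory GRing.Theory Num.Theory.
Import numFieldNormedType.Exports.

Local Open Scope classical_set_scope.
Local Open Scope ring_scope.

Section max_triangular.
Variable d : nat.

Lemma triangular_le_ex : exists k, (k * k.+1 %/ 2 <= d)%N.
Proof. by exists 0%N. Qed.

Lemma triangular_le_ub k : (k * k.+1 %/ 2 <= d -> k <= d)%N.
Proof. by nia. Qed.

(* [k * k.+1] is even, so the Euclidean quotient is exact. *)
Definition kmax : nat := ex_maxn triangular_le_ex triangular_le_ub.

End max_triangular.

Lemma ltNsqrt3 (R : realType) : - Num.sqrt 3 < Num.sqrt 3 :> R.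
Proof. by rewrite gtrN// sqrtr_gt0. Qed.

Section matrices.
Variables (R : realType).

Definition psd_corr_set (d : nat) : set 'M[R]_d :=
  [set M | [/\ M^T = M,
              (forall x : 'cV[R]_d, 0 <= (x^T *m M *m x) 0 0)
            & (forall i, M i i = 1)]].

Definition unit_row_set (d k : nat) : set 'M[R]_(d, k) :=
  [set A | forall i, Num.sqrt (\sum_(j < k) A i j ^+ 2) = 1].

End matrices.
Arguments psd_corr_set R d : clear implicits.
Arguments unit_row_set R d k : clear implicits.

(* A [k]-dimensional random vector is given by its components, a family
   ['I_k -> {RV P >-> R}] on the common probability space. *)
Section probability.
Context (disp : measure_display) (T : measurableType disp) (R : realType)
  (P : probability T R).

Definition atomless : Prop :=
  forall A : set T, measurable A -> (0 < P A)%E ->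
    exists B : set T,
      [/\ measurable B, B `<=` A, (0 < P B)%E & (P B < P A)%E].

Definition pearson (X Y : T -> R) : R :=
  fine (covariance P X Y)
    / (Num.sqrt (fine 'V_P[X]%E) * Num.sqrt (fine 'V_P[Y]%E)).

Definition cdf_transform (X : {RV P >-> R}) : T -> R :=
  fun t => fine (cdf X (X t)).

Definition spearman (X Y : {RV P >-> R}) : R :=
  pearson (cdf_transform X) (cdf_transform Y).

Definition spearman_set (d : nat) : set 'M[R]_d :=
  [set M | exists X : 'I_d -> {RV P >-> R},
     (forall i, continuous (cdf (X i)))
     /\ M = \matrix_(i, j) spearman (X i) (X j)].

(* Both conditions are between extended reals: in this library an expectation
   whose positive and negative parts are both infinite is [-oo], so they force
   integrability (and square-integrability) of the components. *)
Definition standardized (k : nat) (V : 'I_k -> {RV P >-> R}) : Prop :=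
  (forall j, ('E_P[V j] = 0)%E)
  /\ (forall i j, covariance P (V i) (V j) = ((1%:M : 'M[R]_k) i j)%:E).

Definition mulmx_rv (d k : nat) (A : 'M[R]_(d, k)) (V : 'I_k -> {RV P >-> R})
    (i : 'I_d) : T -> R :=
  fun t => (A *m \col_j V j t) i 0.

Lemma measurable_mulmx_rv d k (A : 'M[R]_(d, k)) (V : 'I_k -> {RV P >-> R}) i :
  measurable_fun setT (mulmx_rv A V i).
Proof.
rewrite (_ : mulmx_rv A V i = fun t => \sum_(j < k) A i j * V j t).
  apply: measurable_sum => j; apply: measurable_funM => //.
by apply/funext => t; rewrite /mulmx_rv mxE; apply: eq_bigr => j _; rewrite mxE.
Qed.

HB.instance Definition _ d k (A : 'M[R]_(d, k)) (V : 'I_k -> {RV P >-> R}) i :=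
  isMeasurableFun.Build _ _ _ _ (mulmx_rv A V i) (measurable_mulmx_rv A V i).

(* Equality of laws is restricted to measurable sets, outside of which the
   library's measures take unspecified values. *)
Definition uniform_rv (a b : R) (ab : a < b) (X : {RV P >-> R}) : Prop :=
  forall B : set R, measurable B -> distribution P X B = uniform_prob ab B.

End probability.
Arguments spearman_set {disp T R} P d.
Arguments standardized {disp T R} P {k} V.
Arguments mulmx_rv {disp T R} P {d k} A V i.
Arguments uniform_rv {disp T R} P {a b} ab X.

(* Main.v *)
(** The Spearman's rho matrices are the matrices [12 E(Z_i Z_j) - 3] with [Z]
    a random vector whose components are uniform on [0, 1] (probability integral
    transform), so they are correlation matrices of uniform variables.

    If every correlation matrix is of this form, then so is [A A^T] for [A] with
    unit rows; with [U] the corresponding vector, uniform on [-sqrt 3, sqrt 3],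
    and [B] a pseudo-inverse of [A], take [V = B U + (1 - B A) W] where [W] is
    orthonormal and orthogonal to [1] and [U]; such a [W] exists because an
    atomless space has infinite-dimensional [L^2].  Then [V] is standardized and
    [U - A V] has zero variance.

    Conversely, the images [A V] realize the matrices [A A^T] with [A] having
    [k_d] columns.  Every correlation matrix is a convex combination of those:
    if [B] has [n] columns, unit rows, and [n (n + 1) / 2 > d], some nonzero
    symmetric [H] satisfies [(B H B^T)_ii = 0] for all [i], and moving from
    [B B^T] in the directions [+- B H B^T] until [1 +- t H] is singular writes
    [B B^T] as a combination of Gram matrices with [n - 1] columns.  Finally the
    Spearman's rho matrices are convex: a mixture of two laws on the cube is
    realized on the atomless space by prescribing the joint law of the binary
    digits of the coordinates, splitting events successively (Sierpinski). *)
Require Import Defs.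
From HB Require Import structures.
From mathcomp Require Import all_boot all_order all_algebra zify ring lra.
From mathcomp Require Import all_classical all_reals all_analysis measurable_realfun.

Set Implicit Arguments.
Unset Strict Implicit.
Unset Printing Implicit Defensive.

Import Order.TTheory GRing.Theory Num.Theory.
Import numFieldNormedType.Exports.

Local Open Scope classical_set_scope.
Local Open Scope ring_scope.

(** * Gram matrices and the extreme points of the correlation matrices *)

Section gram.
Variable R : realType.

Definition quad n (M : 'M[R]_n) (x : 'rV[R]_n) : R := (x *m M *m x^T) 0 0.

Definition psd n (M : 'M[R]_n) : Prop := M^T = M /\ forall x, 0 <= quad M x.

Lemma gram_diag m n (B : 'M[R]_(m, n)) i :
  (B *m B^T) i i = \sum_j B i j ^+ 2.
Proof. by rewrite mxE; apply: eq_bigr => j _; rewrite mxE expr2. Qed.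

Lemma gram_diag0 m n (B : 'M[R]_(m, n)) :
  (forall i, (B *m B^T) i i = 0) -> B = 0.
Proof.
move=> h; apply/matrixP => i j; rewrite mxE; apply/eqP.
have := h i; rewrite gram_diag => /psumr_eq0P/(_ j isT)/eqP.
by rewrite sqrf_eq0; apply => k _; exact: sqr_ge0.
Qed.

Lemma gram_trmx m n (B : 'M[R]_(m, n)) : (B *m B^T)^T = B *m B^T.
Proof. by rewrite trmx_mul trmxK. Qed.

Lemma psd_gram m n (B : 'M[R]_(m, n)) : psd (B *m B^T).
Proof.
split=> [|x]; first exact: gram_trmx.
rewrite /quad mulmxA -mulmxA -trmx_mul gram_diag sumr_ge0// => j _.
exact: sqr_ge0.
Qed.

Lemma quadD n (M N : 'M[R]_n) x : quad (M + N) x = quad M x + quad N x.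
Proof. by rewrite /quad mulmxDr mulmxDl mxE. Qed.

Lemma quadZ n a (M : 'M[R]_n) x : quad (a *: M) x = a * quad M x.
Proof. by rewrite /quad -scalemxAr -scalemxAl mxE. Qed.

Lemma quad1 n (x : 'rV[R]_n) : quad 1%:M x = \sum_j x 0 j ^+ 2.
Proof. by rewrite /quad mulmx1 gram_diag. Qed.

(** Cholesky factorization by induction on the size. If the corner entry [a] is positive, its Schur
    complement is again positive semi-definite; if [a] is zero, the rest of its row must vanish. *)
Lemma psd_factor n (M : 'M[R]_n) : psd M -> exists B : 'M[R]_n, M = B *m B^T.
Proof.
elim: n M => [|n IH] M [Msym Mge0].
  by exists 0; apply/matrixP => -[].
rewrite -[n.+1]/(1 + n)%N in M Msym Mge0 *.
pose a := M 0 0; pose v := ursubmx M; pose N := drsubmx M.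
have ME : M = block_mx a%:M v v^T N.
  rewrite -[LHS]submxK; congr block_mx.
    by rewrite [LHS]mx11_scalar !mxE; congr (M _ _)%:M; apply/val_inj.
  by rewrite -[in LHS]Msym -trmx_ursub.
have Nsym : N^T = N by rewrite /N trmx_drsub Msym.
have quadM c (y : 'rV_n) : quad M (row_mx c%:M y)
    = a * c ^+ 2 + 2 * c * (v *m y^T) 0 0 + quad N y.
  rewrite /quad ME mul_row_block tr_row_mx mul_row_col tr_scalar_mx.
  rewrite mulmxDl mxE [in X in X + _]mxE -!scalar_mxM !mul_scalar_mx mulmxDl.
  rewrite -!addrA; congr (_ + _).
    by rewrite !mxE eqxx mulr1n; ring.
  rewrite [X in _ + X]mxE addrA; congr (_ + _).
  rewrite mul_mx_scalar -scalemxAl [X in X + _]mxE [X in _ + X]mxE.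
  have -> : (y *m v^T) 0 0 = (v *m y^T) 0 0.
    by rewrite -[in RHS](trmxK v) -trmx_mul [RHS]mxE.
  by ring.
have a0 : 0 <= a.
  have := Mge0 (row_mx 1%:M 0); rewrite quadM trmx0 !mulmx0 /quad !mul0mx !mxE.
  by rewrite mulr0 !addr0 expr1n mulr1.
have [a_eq0|a_neq0] := eqVneq a 0.
  have v0 : v = 0.
    apply/eqP; rewrite -[_ == _]negbK; apply/negP => vn0.
    have vv : 0 < (v *m v^T) 0 0.
      rewrite lt_neqAle gram_diag sumr_ge0 ?andbT; last by move=> ? _; exact: sqr_ge0.
      rewrite -gram_diag eq_sym; apply: contra vn0 => /eqP h.
      by apply/eqP/gram_diag0 => i; rewrite ord1.
    (* With [a = 0], this first coordinate would give the form the value [-1]. *)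
    have := Mge0 (row_mx (- (quad N v + 1) / (2 * (v *m v^T) 0 0))%:M v).
    rewrite quadM a_eq0 mul0r add0r.
    move: vv; set w := (v *m v^T) 0 0; set q := quad N v => w0.
    have -> : 2 * (- (q + 1) / (2 * w)) * w = - (q + 1).
      by field; rewrite gt_eqF.
    by rewrite opprD addrAC addNr add0r; lra.
  have [|B NB] := IH N.
    split=> // y; have := Mge0 (row_mx (0 : R)%:M y).
    by rewrite quadM a_eq0 !(mul0r, mulr0, add0r).
  exists (block_mx 0 0 0 B).
  rewrite tr_block_mx mulmx_block !trmx0 !(mulmx0, mul0mx) !(addr0, add0r) -NB.
  by rewrite ME a_eq0 v0 trmx0 raddf0.
have agt0 : 0 < a by rewrite lt_neqAle eq_sym a_neq0.
have [|B NB] := IH (N - a^-1 *: (v^T *m v)).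
  split; first by rewrite linearB /= Nsym linearZ/= trmx_mul trmxK.
  (* The form of the Schur complement at [y] is the minimum of the form of [M] over the first
     coordinate, attained here. *)
  move=> y; have := Mge0 (row_mx (- a^-1 * (v *m y^T) 0 0)%:M y); rewrite quadM.
  have -> : quad (N - a^-1 *: (v^T *m v)) y = quad N y - a^-1 * ((v *m y^T) 0 0) ^+ 2.
    rewrite quadD -scaleNr quadZ mulNr; congr (_ - _ * _).
    rewrite /quad mulmxA -mulmxA mxE big_ord1 expr2; congr (_ * _).
    by rewrite -[in RHS](trmxK v) -trmx_mul [RHS]mxE.
  suff -> : a * (- a^-1 * (v *m y^T) 0 0) ^+ 2 +
    2 * (- a^-1 * (v *m y^T) 0 0) * (v *m y^T) 0 0 + quad N y =
    quad N y - a^-1 * (v *m y^T) 0 0 ^+ 2 by [].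
  by field.
pose s := Num.sqrt a.
have s0 : s != 0 by rewrite sqrtr_eq0 -ltNge.
have ss : s * s = a by rewrite -expr2 sqr_sqrtr.
exists (block_mx s%:M 0 (s^-1 *: v^T) B).
rewrite tr_block_mx mulmx_block !trmx0 !(mulmx0, mul0mx) !(addr0, add0r).
rewrite tr_scalar_mx -scalar_mxM ss linearZ /= trmxK -NB ME; congr block_mx.
- by rewrite -scalemxAr mul_scalar_mx scalerA mulVf// scale1r.
- by rewrite mul_mx_scalar scalerA mulfV// scale1r.
by rewrite -scalemxAr -scalemxAl scalerA -invfM ss addrC subrK.
Qed.

(** In a full-rank factorization [B = L *m S], only [S *m S^T] enters the Gram matrix, and it has a
    square factor [D] of size [\rank B]; zero columns pad up to [k]. *)
Lemma gram_rank d n k (B : 'M[R]_(d, n)) : (\rank B <= k)%N ->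
  exists C : 'M[R]_(d, k), B *m B^T = C *m C^T.
Proof.
move=> rk; have [D DE] := psd_factor (psd_gram (row_base B)).
move: (col_base B) (row_base B) (mulmx_base B) D DE => L S BE D DE.
exists (L *m D *m pid_mx (\rank B)).
rewrite !trmx_mul tr_pid_mx !mulmxA -(mulmxA _ (pid_mx _) (pid_mx _)).
rewrite pid_mx_id// pid_mx_1 mulmx1 -(mulmxA _ D) -DE.
by rewrite mulmxA BE -mulmxA -trmx_mul BE.
Qed.

(** From a full-rank factorization [A = L *m S] and a left inverse [L'] of [L]. The two identities
    make [B *m A] the orthogonal projection onto the row space of [A]. *)
Lemma gram_pinv d k (A : 'M[R]_(d, k)) : exists B : 'M[R]_(k, d),
  A *m B *m A = A /\ (B *m A)^T = B *m A.
Proof.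
have [r [L [S [L' [AE L'L Sfree]]]]] : exists r (L : 'M[R]_(d, r))
    (S : 'M[R]_(r, k)) L', [/\ A = L *m S, L' *m L = 1%:M & row_free S].
  have /row_fullP[L' L'L] := col_base_full A.
  exists (\rank A), (col_base A), (row_base A), L'.
  by split; rewrite ?mulmx_base ?row_base_free.
have Su : S *m S^T \in unitmx.
  rewrite -row_free_unit -kermx_eq0; apply/eqP/row_matrixP => i.
  rewrite row0; set x := row i _.
  have : x *m (S *m S^T) = 0 by rewrite -row_mul mulmx_ker row0.
  move=> /(congr1 (mulmx^~ x^T)); rewrite mul0mx mulmxA -mulmxA -trmx_mul => h.
  have /gram_diag0 xS0 : forall i, (x *m S *m (x *m S)^T) i i = 0.
    by move=> j; rewrite h mxE.
  by apply/(row_free_inj Sfree); rewrite xS0 mul0mx.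
exists (S^T *m invmx (S *m S^T) *m L').
have BA : S^T *m invmx (S *m S^T) *m L' *m A = S^T *m invmx (S *m S^T) *m S.
  by rewrite AE mulmxA -(mulmxA _ L') L'L mulmx1.
split.
  rewrite -mulmxA BA AE.
  by rewrite !mulmxA -(mulmxA L) mulmxK.
by rewrite BA !trmx_mul trmxK trmx_inv gram_trmx mulmxA.
Qed.

Lemma continuous_quad n (H : 'M[R]_n) : continuous (quad H).
Proof.
have -> : quad H = fun x => \sum_i (\sum_j x 0 j * H j i) * x 0 i.
  apply/funext => x; rewrite /quad mxE; apply: eq_bigr => i _.
  by rewrite !mxE.
have addc : continuous (fun x : R * R => x.1 + x.2) by exact: add_continuous.
apply: (continuous_big addc) => i _ x.
apply: continuousM; last exact: coord_continuous.
apply: (continuous_big (F := fun j (y : 'rV[R]_n) => y 0 j * H j i) addc) => j _ y.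
by apply: continuousM; [exact: coord_continuous | exact: cst_continuous].
Qed.

(* [l] is the maximum of the quadratic form of [H] on the unit sphere. *)
Lemma max_eigenvalue n (H : 'M[R]_n.+1) : H^T = H ->
  exists (l : R) (x : 'rV[R]_n.+1),
    [/\ x != 0, psd (l%:M - H) & x *m (l%:M - H) = 0].
Proof.
move=> Hsym; pose S : set 'rV[R]_n.+1 := [set x | quad 1%:M x = 1].
have [x Sx xmax] : exists2 c, c \in S &
    forall t, t \in S -> quad H t <= quad H c.
  apply: EVT_max_rV => //.
  - exists (delta_mx 0 0); rewrite /S/= quad1 (bigD1 0)//= mxE !eqxx expr1n.
    rewrite big1 ?addr0// => j j0; rewrite mxE eqxx (negbTE j0)/=.
    by rewrite expr0n.
  - apply: bounded_closed_compact.
      exists 1; split=> // M M1 x /= Sx.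
      change (mx_norm x <= M); rewrite mx_normrE; apply/bigmax_leP; split; first lra.
      move=> [i j] _ /=; rewrite ord1.
      rewrite -(ler_pXn2r (ltn0Sn 1)) ?nnegrE//; last lra.
      rewrite real_normK ?num_real// (@le_trans _ _ 1)//; last nra.
      rewrite -Sx quad1 (bigD1 j)//= lerDl sumr_ge0// => k _.
      exact: sqr_ge0.
    rewrite (_ : S = quad 1%:M @^-1` [set 1]); last by [].
    by apply: closed_comp => // y _; exact: continuous_quad.
  - exact/continuous_subspaceT/continuous_quad.
move: Sx; rewrite inE /S/= => Sx.
have x0 : x != 0.
  apply/eqP => x0; move: Sx; rewrite x0 quad1 big1 => [|j _].
    by move=> /eqP; rewrite eq_sym oner_eq0.
  by rewrite mxE expr0n.
have quadl l y : quad (l%:M - H) y = l * quad 1%:M y - quad H y.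
  by rewrite quadD -scaleN1r quadZ -[l%:M]scalemx1 quadZ mulN1r.
exists (quad H x), x.
have lpsd : psd ((quad H x)%:M - H).
  split; first by rewrite linearB /= tr_scalar_mx Hsym.
  move=> y; rewrite quadl subr_ge0.
  have [y0|yn0] := eqVneq y 0; first by rewrite y0 /quad !mul0mx mxE mulr0.
  have q0 : 0 < quad 1%:M y.
    rewrite lt_neqAle quad1 sumr_ge0 ?andbT; last by move=> ? _; exact: sqr_ge0.
    rewrite eq_sym; apply: contra yn0 => /eqP h.
    by apply/eqP/gram_diag0 => i; rewrite ord1 gram_diag.
  pose c := Num.sqrt (quad 1%:M y).
  have c0 : 0 < c by rewrite sqrtr_gt0.
  have quads M : quad M (c^-1 *: y) = c^-1 ^+ 2 * quad M y.
    by rewrite /quad -!scalemxAl linearZ/= -scalemxAr scalerA mxE expr2.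
  have cq : c ^+ 2 = quad 1%:M y by rewrite sqr_sqrtr// ltW.
  have : c^-1 *: y \in S by rewrite inE /S/= quads -cq -exprMn mulVf ?expr1n ?gt_eqF.
  move=> /xmax; rewrite quads exprVn cq mulrC ler_pdivrMr//.
split=> //.
(* A positive semi-definite form that vanishes at [x] has [x] in its kernel: its value there is the
   squared norm of [x *m C]. *)
have [C CE] := psd_factor lpsd.
have xC : x *m C = 0.
  apply: gram_diag0 => i; rewrite ord1 trmx_mul mulmxA -(mulmxA x) -CE.
  by rewrite -/(quad _ _) quadl Sx mulr1 subrr.
by rewrite CE mulmxA xC mul0mx.
Qed.

(** These pairs index a basis of the symmetric matrices of size [n]. *)
Lemma triangular_card n :
  #|[pred p : 'I_n * 'I_n | (p.1 <= p.2)%N]| = (n * n.+1 %/ 2)%N.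
Proof.
rewrite -sum1_card (eq_bigl (fun p : 'I_n * 'I_n => true && (p.1 <= p.2)%N))//.
rewrite -(pair_big_dep xpredT (fun i j : 'I_n => (i <= j)%N) (fun _ _ => 1%N))/=.
rewrite (exchange_big_dep xpredT)//=.
rewrite (eq_bigr (fun j : 'I_n => j.+1)) => [|j _]; last first.
  rewrite -(big_ord_widen_cond _ xpredT (fun=> 1%N) (ltn_ord j)).
  by rewrite sum1_card card_ord.
by elim: n => [|n IH]; rewrite ?big_ord0// big_ord_recr/= IH; lia.
Qed.

(** Dimension count: the diagonal conditions are [d] linear equations on a space of dimension
    [n * n.+1 %/ 2]. *)
Lemma exists_sym_diag0 d n (B : 'M[R]_(d, n)) : (d < n * n.+1 %/ 2)%N ->
  exists H : 'M[R]_n, [/\ H^T = H, H != 0 & forall i, (B *m H *m B^T) i i = 0].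
Proof.
rewrite -triangular_card; set A := [pred _ | _] => dA.
pose G : 'M[R]_(#|A|, d) :=
  \matrix_(k, i) (B i (enum_val k).1 * B i (enum_val k).2).
have : kermx G != 0.
  by rewrite kermx_eq0 /row_free neq_ltn (leq_ltn_trans (rank_leq_col G)).
case/rowV0Pn => u /sub_kermxP uG u0.
(* The solution is first built upper triangular. Symmetrizing it preserves the conditions, since a
   matrix and its transpose share their diagonal. *)
pose T := \sum_k u 0 k *: delta_mx (enum_val k).1 (enum_val k).2 : 'M[R]_n.
have TE a b : T a b = \sum_k u 0 k * (enum_val k == (a, b))%:R.
  rewrite summxE; apply: eq_bigr => k _; rewrite !mxE eq_sym (eq_sym b).
  by case: (enum_val k).
have BTB i : (B *m T *m B^T) i i = 0.
  transitivity ((u *m G) 0 i); last by rewrite uG mxE.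
  rewrite mulmx_sumr mulmx_suml summxE [RHS]mxE; apply: eq_bigr => k _.
  rewrite -scalemxAr -scalemxAl mxE; congr (_ * _).
  rewrite mxE (bigD1 (enum_val k).2)//= big1 ?addr0 => [|j jk].
    rewrite !mxE (bigD1 (enum_val k).1)//= big1 ?addr0 => [|j jk].
      by rewrite mxE !eqxx mulr1.
    by rewrite !mxE (negbTE jk) mulr0.
  rewrite !mxE big1 ?mul0r// => l _.
  by rewrite mxE (negbTE jk) andbF mulr0.
exists (T + T^T); split.
- by rewrite linearD/= trmxK addrC.
- have [k uk] : exists k, u 0 k != 0.
    apply/existsP; rewrite -[X in is_true X]negbK negb_exists.
    apply: contra u0 => /forallP h; apply/eqP/rowP => k; rewrite mxE.
    by apply/eqP; move: (h k); rewrite negbK.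
  have := enum_valP k; rewrite inE.
  case Eab : (enum_val k) => [a b]/= ab.
  have Tab : T a b = u 0 k.
    rewrite TE (bigD1 k)//= Eab eqxx mulr1 big1 ?addr0// => l lk.
    by rewrite -Eab (inj_eq enum_val_inj) (negbTE lk) mulr0.
  (* The transposed entry equals this one if [a = b] and is zero otherwise, [T] being upper
     triangular, so nothing cancels. *)
  apply/eqP => /matrixP/(_ a b); rewrite !mxE Tab.
  have [ba|ba] := eqVneq b a.
    by move: Tab; rewrite ba => -> /eqP; rewrite -mulr2n mulrn_eq0/= (negbTE uk).
  rewrite TE big1 ?addr0 => [/eqP|l _]; first by rewrite (negbTE uk).
  case: eqP => [Eba|]; last by rewrite mulr0.
  have := enum_valP l; rewrite Eba inE/= => ba'.
  by case/eqP: ba; apply/val_inj/eqP; rewrite eqn_leq ab ba'.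
- move=> i; rewrite mulmxDr mulmxDl mxE BTB add0r.
  have <- : (B *m T *m B^T)^T = B *m T^T *m B^T.
    by rewrite !trmx_mul trmxK mulmxA.
  by rewrite mxE BTB.
Qed.

(** With [H = D *m D^T] this is the Gram matrix of [B *m D], whose diagonal holds the squared norms
    of the rows. *)
Lemma psd_conj_diag0 d n (B : 'M[R]_(d, n)) (H : 'M[R]_n) : psd H ->
  (forall i, (B *m H *m B^T) i i = 0) -> B *m H *m B^T = 0.
Proof.
move=> /psd_factor[D ->] h.
suff -> : B *m (D *m D^T) *m B^T = (B *m D) *m (B *m D)^T.
  by rewrite (_ : B *m D = 0) ?mul0mx//; apply: gram_diag0 => i; rewrite -(h i)
    trmx_mul !mulmxA.
by rewrite trmx_mul !mulmxA.
Qed.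

(* Subtracting from [I] the multiple of [H] that makes it singular. *)
Lemma gram_sub_rank d n (B : 'M[R]_(d, n.+1)) (H : 'M[R]_n.+1) :
  H^T = H -> psd (- H) \/ exists (l : R) (C : 'M[R]_(d, n)),
    0 < l /\ C *m C^T = B *m B^T - l^-1 *: (B *m H *m B^T).
Proof.
move=> Hsym; have [l [x [x0 lpsd xl]]] := max_eigenvalue Hsym.
have [l0|l0] := leP l 0.
  left; split; first by rewrite linearN/= Hsym.
  move=> y; have [_ /(_ y)] := lpsd.
  rewrite quadD -[l%:M]scalemx1 quadZ quad1.
  have : 0 <= \sum_j y 0 j ^+ 2 by rewrite sumr_ge0// => j _; exact: sqr_ge0.
  nra.
right; exists l.
have [C CE] := psd_factor lpsd.
(* Since [x *m C = 0] with [x] nonzero, [C] is singular and one column can be saved. *)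
have [|D DE] := @gram_rank d n.+1 n (Num.sqrt l^-1 *: (B *m C)).
  rewrite (leq_trans (mxrank_scale _ _))// (leq_trans (mxrankM_maxr _ _))//.
  rewrite -ltnS ltn_neqAle rank_leq_row andbT.
  apply: contra x0 => fC; apply/eqP/(row_free_inj fC); rewrite mul0mx.
  by apply: gram_diag0 => i; rewrite trmx_mul mulmxA -(mulmxA x) -CE xl mul0mx mxE.
exists D; split=> //.
rewrite -DE linearZ/= -scalemxAr -scalemxAl scalerA -expr2 sqr_sqrtr ?invr_ge0 ?ltW//.
have -> : B *m C *m (B *m C)^T = B *m (C *m C^T) *m B^T.
  by rewrite trmx_mul !mulmxA.
rewrite -CE mulmxBr mulmxBl scalerBr; congr (_ - _).
by rewrite mul_mx_scalar -scalemxAl scalerA mulVf ?gt_eqF// scale1r.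
Qed.

Definition unit_diag d (M : 'M[R]_d) := forall i, M i i = 1.

Lemma gram_reduce d n (B : 'M[R]_(d, n.+1)) : (d < n.+1 * n.+2 %/ 2)%N ->
  unit_diag (B *m B^T) ->
  exists (C D : 'M[R]_(d, n)) (t : R),
    [/\ unit_diag (C *m C^T), unit_diag (D *m D^T), 0 <= t <= 1 &
        B *m B^T = t *: (C *m C^T) + (1 - t) *: (D *m D^T)].
Proof.
move=> dn B1; have [H [Hsym H0 BHB]] := exists_sym_diag0 B dn.
have NHsym : (- H)^T = - H by rewrite linearN/= Hsym.
have NBHB i : (B *m (- H) *m B^T) i i = 0.
  by rewrite mulmxN mulNmx mxE BHB oppr0.
have unitC l (C : 'M[R]_(d, n)) (K : 'M[R]_n.+1) :
    (forall i, (B *m K *m B^T) i i = 0) ->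
    C *m C^T = B *m B^T - l^-1 *: (B *m K *m B^T) -> unit_diag (C *m C^T).
  move=> hK -> i; rewrite [LHS]mxE [X in _ + X]mxE [X in - X]mxE hK.
  by rewrite mulr0 subr0.
(* The degenerate case: for [K] positive semi-definite the zero diagonal forces [B *m K *m B^T = 0],
   so [C] alone has the Gram matrix of [B]. *)
have one l (C : 'M[R]_(d, n)) (K : 'M[R]_n.+1) :
    (forall i, (B *m K *m B^T) i i = 0) -> psd K ->
    C *m C^T = B *m B^T - l^-1 *: (B *m K *m B^T) ->
    exists (C D : 'M[R]_(d, n)) (t : R),
    [/\ unit_diag (C *m C^T), unit_diag (D *m D^T), 0 <= t <= 1 &
        B *m B^T = t *: (C *m C^T) + (1 - t) *: (D *m D^T)].
  move=> hK Kpsd CE; exists C, C, 1.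
  split; [exact: unitC CE | exact: unitC CE | by rewrite ler01 lexx |].
  rewrite scale1r subrr scale0r addr0 CE psd_conj_diag0//.
  by rewrite scaler0 subr0.
have [NHpsd|[l [C [l0 CE]]]] := gram_sub_rank B Hsym.
  have [|[m [D [m0 DE]]]] := gram_sub_rank B NHsym; last exact: one NHpsd DE.
  (* If [H] and [- H] are both positive semi-definite, the diagonal of [H] vanishes, hence so does
     [H]. *)
  rewrite opprK => Hpsd; case/eqP: H0.
  have := @psd_conj_diag0 n.+1 n.+1 1%:M H Hpsd.
  rewrite mul1mx trmx1 mulmx1; apply => i.
  have diagE (K : 'M[R]_n.+1) : quad K (delta_mx 0 i) = K i i.
    by rewrite /quad trmx_delta -rowE -colE !mxE.
  apply/eqP; rewrite eq_le; apply/andP; split.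
    by case: NHpsd => _ /(_ (delta_mx 0 i)); rewrite diagE mxE oppr_ge0.
  by case: Hpsd => _ /(_ (delta_mx 0 i)); rewrite diagE.
have [|[m [D [m0 DE]]]] := gram_sub_rank B NHsym.
  by rewrite opprK => Hpsd; exact: one Hpsd CE.
have lm : 0 < l + m by rewrite addr_gt0.
(* The weight for which the displacements [- l^-1] and [m^-1] along [B *m H *m B^T] cancel. *)
exists C, D, (l / (l + m)).
split; [exact: unitC CE | exact: unitC DE | |].
  by rewrite divr_ge0 ?(ltW l0) ?(ltW lm)//= ler_pdivrMr// mul1r lerDl ltW.
rewrite CE DE mulmxN mulNmx scalerN opprK scalerBr scalerDr !scalerA.
rewrite addrACA -scalerDl -scaleNr -scalerDl.
rewrite [X in X *: _ + _](_ : _ = 1) ?scale1r; last by ring.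
rewrite [X in _ + X *: _](_ : _ = 0) ?scale0r ?addr0//.
by field; rewrite !(gt_eqF l0, gt_eqF m0, gt_eqF lm).
Qed.

Lemma unit_row_gram d k (A : 'M[R]_(d, k)) :
  unit_row_set R d k A <-> unit_diag (A *m A^T).
Proof.
split=> h i; move: (h i); rewrite gram_diag.
  have s0 : 0 <= \sum_j A i j ^+ 2 by rewrite sumr_ge0// => j _; exact: sqr_ge0.
  by move=> /(congr1 (fun x => x ^+ 2)); rewrite sqr_sqrtr// expr1n.
by move=> ->; rewrite sqrtr1.
Qed.

(** Induction on the number [m] of columns in excess of [kmax d]; [gram_reduce] removes them one at
    a time. *)
Lemma psd_corr_set_ind d (Q : 'M[R]_d -> Prop) :
  (forall (M N : 'M[R]_d) t, 0 <= t <= 1 -> Q M -> Q N ->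
     Q (t *: M + (1 - t) *: N)) ->
  (forall A : 'M[R]_(d, kmax d), unit_row_set R d (kmax d) A -> Q (A *m A^T)) ->
  forall M, psd_corr_set R d M -> Q M.
Proof.
move=> Qconv Qk M [Msym Mge0 M1].
have QB m (B : 'M[R]_(d, m + kmax d)) : unit_diag (B *m B^T) -> Q (B *m B^T).
  elim: m B => [|m IH] B B1; first exact/Qk/unit_row_gram.
  have [|C [D [t [C1 D1 t01 ->]]]] := @gram_reduce d (m + kmax d) B _ B1.
    (* By maximality of [kmax d], any larger number of columns has its triangular number above
       [d]. *)
    rewrite ltnNge; apply/negP => /=.
    rewrite /kmax; case: ex_maxnP => k _ kub /kub; lia.
  by apply: Qconv => //; exact: IH.
have [|B MB] := @psd_factor _ M.
  by split=> // x; have := Mge0 x^T; rewrite trmxK.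
have [|C MC] := @gram_rank d d (d + kmax d) B.
  by rewrite (leq_trans (rank_leq_col B))// leq_addr.
by rewrite MB MC; apply: QB; rewrite -MC -MB.
Qed.

End gram.

(** * Atomless probability spaces *)

Section atomless.
Context (disp : measure_display) (T : measurableType disp) (R : realType)
  (P : probability T R).

Definition pr (A : set T) : R := fine (P A).

Lemma prE A : measurable A -> P A = (pr A)%:E.
Proof. by move=> mA; rewrite fineK// fin_num_measure. Qed.

Lemma pr_ge0 A : 0 <= pr A.
Proof. exact/fine_ge0/measure_ge0. Qed.

Lemma pr_setT : pr setT = 1.
Proof. by rewrite /pr probability_setT. Qed.

Lemma pr_le A B : measurable A -> measurable B -> A `<=` B -> pr A <= pr B.
Proof.
by move=> mA mB AB; rewrite -lee_fin -!prE// le_measure// inE.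
Qed.

Lemma pr_le1 A : measurable A -> pr A <= 1.
Proof. by move=> mA; rewrite -pr_setT pr_le. Qed.

Lemma prD A B : measurable A -> measurable B -> B `<=` A ->
  pr (A `\` B) = pr A - pr B.
Proof.
move=> mA mB BA; apply: EFin_inj; rewrite -prE; last exact: measurableD.
rewrite measureD//; last by rewrite (le_lt_trans (probability_le1 _ _))// ltry.
by rewrite setIidr// EFinB -!prE.
Qed.

Lemma prU A B : measurable A -> measurable B -> A `&` B = set0 ->
  pr (A `|` B) = pr A + pr B.
Proof.
move=> mA mB AB0; apply: EFin_inj; rewrite -prE; last exact: measurableU.
by rewrite measureU// EFinD -!prE.
Qed.

Hypothesis hP : atomless P.

Lemma atomless_split A : measurable A -> 0 < pr A ->
  exists B, [/\ measurable B, B `<=` A, 0 < pr B & pr B < pr A].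
Proof.
move=> mA; rewrite -lte_fin -prE// => /(hP mA)[B [mB BA B0 Blt]].
by exists B; split; rewrite // -lte_fin -!prE.
Qed.

(** Either [B] or its complement in [A] has at most half of the mass. *)
Lemma atomless_half A : measurable A -> 0 < pr A ->
  exists B, [/\ measurable B, B `<=` A, 0 < pr B & pr B <= pr A / 2].
Proof.
move=> mA A0; have [B [mB BA B0 Blt]] := atomless_split mA A0.
have [h|h] := leP (pr B) (pr A / 2); first by exists B.
exists (A `\` B); split=> //; [exact: measurableD | rewrite prD//; lra..].
Qed.

Lemma atomless_small A e : measurable A -> 0 < pr A -> 0 < e ->
  exists B, [/\ measurable B, B `<=` A, 0 < pr B & pr B <= e].
Proof.
move=> mA A0 e0.
have H n : exists B, [/\ measurable B, B `<=` A, 0 < pr B & pr B <= 2^-1 ^+ n].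
  elim: n => [|n [B [mB BA B0 Bn]]]; first by exists A; split; rewrite ?expr0 ?pr_le1.
  have [C [mC CB C0 Cn]] := atomless_half mB B0.
  exists C; split=> //; first exact: subset_trans BA.
  by rewrite exprSr (le_trans Cn)// ler_pM2r// invr_gt0.
have [n hn] : exists n, 2^-1 ^+ n < e :> R.
  have : (fun n => 2^-1 ^+ n : R) @ \oo --> (0 : R).
    by apply: cvg_expr; rewrite ger0_norm; lra.
  move=> /cvgrPdist_lt/(_ e e0)[n _ /(_ n (leqnn _))] /=.
  rewrite sub0r normrN ger0_norm ?exprn_ge0 ?invr_ge0// => ?.
  by exists n.
have [B [mB BA B0 Bn]] := H n.
by exists B; split=> //; rewrite (le_trans Bn)// ltW.
Qed.

(* One step of the greedy exhaustion: the increment is at least half of the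
   largest admissible one. *)
Let greedy_step A q B : measurable A -> measurable B -> B `<=` A -> pr B <= q ->
  exists B', [/\ measurable B', B' `<=` A, B `<=` B', pr B' <= q &
    forall C, measurable C -> C `<=` A `\` B -> pr B + pr C <= q ->
      pr C <= 2 * (pr B' - pr B)].
Proof.
move=> mA mB BA Bq.
pose S := [set x | exists C, [/\ measurable C, C `<=` A `\` B,
  pr B + pr C <= q & x = pr C]].
have hS : has_sup S.
  split; first by exists (pr set0), set0; split; rewrite // /pr measure0 addr0.
  by exists 1 => _ [C [mC _ _ ->]]; exact: pr_le1.
have [s0|s0] := leP (sup S) 0.
  exists B; split=> // C mC CA Cq; rewrite subrr mulr0 (le_trans _ s0)//.
  by apply: sup_upper_bound => //; exists C.
have [_ [C [mC CA Cq ->]] sC] := sup_adherent (divr_gt0 s0 (ltr0n R 2)) hS.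
have BC0 : B `&` C = set0.
  by rewrite -subset0 => t [Bt /CA[]].
exists (B `|` C); split; first exact: measurableU.
- by rewrite subUset; split=> // t /CA[].
- exact: subsetUl.
- by rewrite prU.
move=> D mD DA Dq; rewrite prU// addrC addKr.
have : pr D <= sup S by apply: sup_upper_bound => //; exists D.
lra.
Qed.

(** Sierpinski's theorem by greedy exhaustion. If the union [B] of the steps had mass below [q], a
    small event [C] outside [B] would have been admissible at every step, so each increment would be
    at least half of [pr C] and the masses would exceed 1. *)
Lemma atomless_intermediate A q : measurable A -> 0 <= q <= pr A ->
  exists B, [/\ measurable B, B `<=` A & pr B = q].
Proof.
move=> mA /andP[q0 qA].
pose good B := [/\ measurable B, B `<=` A & pr B <= q].
have /choice[f fP] : forall B, exists B', good B -> [/\ good B', B `<=` B' &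
    forall C, measurable C -> C `<=` A `\` B -> pr B + pr C <= q ->
      pr C <= 2 * (pr B' - pr B)].
  move=> B; have [[mB BA Bq]|nB] := pselect (good B); last by exists B.
  have [B' [mB' B'A BB' B'q h]] := greedy_step mA mB BA Bq.
  by exists B'.
pose b n := iter n f set0.
have bgood n : good (b n).
  elim: n => [|n IH]; first by split; rewrite //= /pr measure0.
  by have [] := fP _ IH.
have mb n : measurable (b n) by have [] := bgood n.
have b_nd : nondecreasing_seq b.
  by apply/nondecreasing_seqP => n; apply/subsetPset; have [] := fP _ (bgood n).
pose B := \bigcup_n b n.
have mB : measurable B by exact: bigcup_measurable.
have BA : B `<=` A by move=> t [n _]; have [_ h _] := bgood n; exact: h.
have Bq : pr B <= q.
  rewrite -lee_fin -prE//.
  have cv : (P \o b) n @[n --> \oo] --> P B by exact: nondecreasing_cvg_mu.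
  rewrite -(cvg_lim _ cv)//; apply: lime_le; first by apply/cvg_ex; exists (P B).
  by apply: nearW => n /=; rewrite prE// lee_fin; have [] := bgood n.
exists B; split=> //; apply/eqP; rewrite eq_le Bq /= leNgt; apply/negP => Blt.
have AB0 : 0 < pr (A `\` B) by rewrite prD//; lra.
have qB : 0 < q - pr B by lra.
have [C [mC CAB C0 Cq]] := atomless_small (measurableD mA mB) AB0 qB.
have step n : pr C <= 2 * (pr (b n.+1) - pr (b n)).
  have [_ _] := fP _ (bgood n); apply=> //.
    by move=> t /CAB[At nBt]; split=> // bt; apply: nBt; exists n.
  have : pr (b n) <= pr B by apply: pr_le => // t bt; exists n.
  lra.
have sumC n : pr C *+ n <= 2 * pr (b n).
  elim: n => [|n IH]; first by rewrite mulr0n mulr_ge0// pr_ge0.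
  by rewrite mulrSr; move: (step n); lra.
have [n hn] : exists n, 2 < pr C *+ n.
  exists (Num.bound (2 / pr C)); have := archi_boundP (divr_ge0 (ler0n R 2) (ltW C0)).
  move=> h; rewrite -[ltLHS](divfK (lt0r_neq0 C0)) -[ltRHS]mulr_natl.
  by rewrite ltr_pM2r.
by have := sumC n; have := pr_le1 (mb n); lra.
Qed.

End atomless.
Arguments pr {disp T R} P A.

(** * Sequences of random bits with prescribed law *)

Section random_bits.
Context (disp : measure_display) (T : measurableType disp) (R : realType)
  (P : probability T R).

Definition cylinder (D : nat -> T -> bool) (w : seq bool) : set T :=
  [set t | mkseq (D^~ t) (size w) = w].

Lemma cylinder_nil D : cylinder D [::] = setT.
Proof. exact/seteqP. Qed.

Lemma cylinder_rcons D w b :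
  cylinder D (rcons w b) = cylinder D w `&` [set t | D (size w) t = b].
Proof.
apply/seteqP; split=> t; rewrite /cylinder /= size_rcons mkseqS.
  by move=> /rcons_inj[-> ->].
by move=> [-> ->].
Qed.

Lemma measurable_cylinder (D : nat -> T -> bool) :
  (forall n, measurable [set t | D n t]) -> forall w, measurable (cylinder D w).
Proof.
move=> mD; elim/last_ind => [|w b IH]; first by rewrite cylinder_nil.
rewrite cylinder_rcons; apply: measurableI => //; case: b; first exact: mD.
rewrite (_ : [set _ | _] = ~` [set t | D (size w) t]); first exact: measurableC.
by apply/seteqP; split=> t /=; case: (D _ t).
Qed.

Lemma pr_cylinder (D : nat -> T -> bool) : (forall n, measurable [set t | D n t]) ->
  forall w, pr P (cylinder D w) =
    pr P (cylinder D (rcons w false)) + pr P (cylinder D (rcons w true)).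
Proof.
move=> mD w; rewrite -prU; last 3 first.
- exact: measurable_cylinder.
- exact: measurable_cylinder.
- by rewrite !cylinder_rcons -subset0 => t [[_ /= ->] []].
rewrite !cylinder_rcons -setIUr; congr pr; apply/seteqP; split=> t; last by case.
by move=> h; split=> //=; case: (D _ t); [right|left].
Qed.

Hypothesis hP : atomless P.

(** Starting from the whole space, the event of each word is split by Sierpinski's theorem into the
    events of its two one-letter extensions. The digits at a point are read off from the events that
    contain it. *)
Lemma random_bits (p : seq bool -> R) : p [::] = 1 -> (forall w, 0 <= p w) ->
    (forall w, p w = p (rcons w false) + p (rcons w true)) ->
  exists D : nat -> T -> bool, (forall n, measurable [set t | D n t]) /\
    forall w, pr P (cylinder D w) = p w.
Proof.
move=> p1 p0 pS.
have /choice[sp spP] : forall Aq : set T * R, exists B, measurable Aq.1 ->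
    0 <= Aq.2 <= pr P Aq.1 -> [/\ measurable B, B `<=` Aq.1 & pr P B = Aq.2].
  move=> [A q]; have [[mA qA]|h] := pselect (measurable A /\ 0 <= q <= pr P A).
    by have [B] := atomless_intermediate hP mA qA; exists B.
  by exists set0 => /= mA qA; case: h.
(* [E] is indexed by reversed words. *)
pose fix E (w : seq bool) : set T := if w is b :: w' then
   let S := sp (E w', p (rcons (rev w') false)) in if b then E w' `\` S else S
  else setT.
have EP w : measurable (E w) /\ pr P (E w) = p (rev w).
  elim: w => [|b w [mE prE]]; first by rewrite /= pr_setT p1.
  have [||mS SE prS] := spP (E w, p (rcons (rev w) false)); rewrite //=.
    by rewrite p0/= prE (pS (rev w)) lerDl.
  rewrite rev_cons /=; case: b => //; split; first exact: measurableD.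
  by rewrite prD// prS prE (pS (rev w)) [LHS]addrC addKr.
have SE w : E (false :: w) `<=` E w.
  have [mE prE] := EP w.
  have [||//] := spP (E w, p (rcons (rev w) false)); rewrite //=.
  by rewrite p0/= prE (pS (rev w)) lerDl.
(* [W n t] is the reversed word of length [n] whose event contains [t]; the next digit is false
   exactly on the piece cut out by [sp]. *)
pose fix W (n : nat) (t : T) {struct n} : seq bool := if n is n'.+1 then
  ~~ `[< E (false :: W n' t) t >] :: W n' t else [::].
pose D n t := ~~ `[< E (false :: W n t) t >].
have WD n t : W n t = rev (mkseq (D^~ t) n).
  by elim: n => //= n IH; rewrite mkseqS rev_rcons -IH.
have sW n t : size (W n t) = n by rewrite WD size_rev size_mkseq.
have WE n t : E (W n t) t.
  elim: n => //= n IH; case: asboolP => //= h.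
have EW w t : E w t -> W (size w) t = w.
  elim: w => //= b w IH.
  case: b => /= [[/IH Ewt nS]|Swt].
    by rewrite Ewt; congr (_ :: _); apply/negP => /asboolP.
  rewrite IH; last exact: SE.
  by congr (_ :: _); apply/negbTE; rewrite negbK; apply/asboolP.
have cE w : cylinder D w = E (rev w).
  apply/seteqP; split=> t.
    by rewrite /cylinder/= => h; rewrite -[in rev w]h -WD.
  by move=> /EW; rewrite size_rev WD => /(congr1 rev); rewrite !revK.
exists D; split; last by move=> w; rewrite cE; have [_ ->] := EP (rev w); rewrite revK.
move=> n.
(* Measurability: digit [n] is true on the finite union of the events of the words of length [n.+1]
   ending in [true]. *)
rewrite (_ : [set t | D n t] = \big[setU/set0]_(w : n.-tuple bool) E (true :: rev w)).
  by apply: bigsetU_measurable => w _; have [] := EP (true :: rev w).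
apply/seteqP; split=> t /=.
  move=> Dt; rewrite -bigcup_seq; exists (mktuple (fun i : 'I_n => D i t)) => /=.
    by rewrite mem_index_enum.
  have -> : rev [seq D (i : 'I_n) t | i <- enum 'I_n] = W n t.
    by rewrite WD /mkseq -val_enum_ord -map_comp.
  split=> [|h]; first exact: WE.
  by move: Dt; rewrite /D => /negP; apply; apply/asboolP.
rewrite -bigcup_seq => -[w _ Et].
have := EW (true :: rev w) t Et.
by rewrite [size _]/= size_rev size_tuple => -[Dt _]; exact: Dt.
Qed.

End random_bits.

(** * Means and uniform laws *)

Section mean.
Context (disp : measure_display) (T : measurableType disp) (R : realType)
  (P : probability T R).
Implicit Types f g : T -> R.

Definition mean f : R := fine 'E_P[f].

Local Notation L1 := (Lfun P 1).
Local Notation L2 := (Lfun P 2%:E).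

Lemma mean_cst c : mean (fun=> c) = c.
Proof. by rewrite /mean (expectation_cst P c). Qed.

Lemma meanE f : f \in L1 -> 'E_P[f]%E = (mean f)%:E.
Proof. by move=> fL; rewrite fineK// expectation_fin_num. Qed.

Lemma meanD f g : f \in L1 -> g \in L1 ->
  mean (fun t => f t + g t) = mean f + mean g.
Proof.
move=> fL gL; rewrite /mean -[X in fine 'E_P[X]]/(f \+ g).
by rewrite expectationD// fineD// expectation_fin_num.
Qed.

Lemma meanZ c f : f \in L1 -> mean (fun t => c * f t) = c * mean f.
Proof.
move=> fL; have -> : (fun t => c * f t) = c \o* f.
  by apply/funext => t /=; rewrite mulrC.
by rewrite /mean expectationZl// fineM// expectation_fin_num.
Qed.

Lemma LfunZ c f r : 1 <= r -> f \in Lfun P r%:E -> (fun t => c * f t) \in Lfun P r%:E.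
Proof.
move=> r1 fL; have -> : (fun t => c * f t) = c \o* f.
  by apply/funext => t /=; rewrite mulrC.
exact: Lfun_scale.
Qed.

Lemma LfunD f g r : 1 <= r -> f \in Lfun P r%:E -> g \in Lfun P r%:E ->
  (fun t => f t + g t) \in Lfun P r%:E.
Proof. by move=> r1 fL gL; rewrite (_ : (fun _ => _) = f + g)// rpredD. Qed.

Lemma Lfun_sum (I : Type) (s : seq I) (F : I -> T -> R) r : 1 <= r ->
  (forall i, F i \in Lfun P r%:E) ->
  (fun t => \sum_(i <- s) F i t) \in Lfun P r%:E.
Proof.
move=> r1 FL; rewrite (_ : (fun t => _) = \sum_(i <- s) F i); last first.
  by apply/funext => t; rewrite fct_sumE.
exact: rpred_sum.
Qed.

Lemma Lfun1_cst c : (fun=> c) \in L1.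
Proof. exact: Lfun_cst. Qed.

Lemma mean_sum (I : Type) (s : seq I) (F : I -> T -> R) :
  (forall i, F i \in L1) ->
  mean (fun t => \sum_(i <- s) F i t) = \sum_(i <- s) mean (F i).
Proof.
move=> FL; elim: s => [|i s IH].
  by rewrite big_nil -[RHS](mean_cst 0); congr mean; apply/funext => t; rewrite big_nil.
rewrite big_cons -IH -meanD//; last exact: Lfun_sum.
by congr mean; apply/funext => t; rewrite big_cons.
Qed.

Lemma Lfun2_Lfun1 f : f \in L2 -> f \in L1.
Proof. by apply: Lfun_subset12; rewrite fin_num_measure. Qed.

Lemma Lfun2_measurable f : f \in L2 -> measurable_fun setT f.
Proof. by rewrite inE => /andP[]; rewrite inE. Qed.

Lemma meanB f g : f \in L1 -> g \in L1 ->
  mean (fun t => f t - g t) = mean f - mean g.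
Proof.
move=> fL gL; have -> : (fun t => f t - g t) = (fun t => f t + -1 * g t).
  by apply/funext => t; rewrite mulN1r.
by rewrite meanD ?LfunZ// meanZ// mulN1r.
Qed.

Lemma mean_ge0 f : (forall t, 0 <= f t) -> 0 <= mean f.
Proof. by move=> f0; rewrite fine_ge0// expectation_ge0. Qed.

Lemma le_mean f g : f \in L1 -> g \in L1 -> (forall t, f t <= g t) ->
  mean f <= mean g.
Proof.
move=> fL gL fg; rewrite -subr_ge0 -meanB// mean_ge0// => t.
by rewrite subr_ge0.
Qed.

Lemma mean_indic A : measurable A -> mean \1_A = pr P A.
Proof. by move=> mA; rewrite /mean expectation_indic. Qed.

Lemma Lfun2_sqr f : measurable_fun setT f ->
  (\int[P]_t (f t ^+ 2)%:E < +oo)%E -> f \in L2.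
Proof.
move=> mf fy; rewrite inE; apply/andP; split; rewrite inE//=.
rewrite /finite_norm unlock /Lnorm poweR_lty//.
rewrite (eq_integral (fun t => (f t ^+ 2)%:E))// => t _.
by rewrite /= powR_mulrn// -normrX ger0_norm// sqr_ge0.
Qed.

Lemma bounded_Lfun2 f (M : R) : measurable_fun setT f -> (forall t, `|f t| <= M) ->
  f \in L2.
Proof.
move=> mf fM; apply: Lfun2_sqr => //.
apply: (@le_lt_trans _ _ (\int[P]_t (M ^+ 2)%:E)%E); last first.
  by rewrite integral_cst//= probability_setT mule1 ltry.
apply: ge0_le_integral => //.
- by move=> t _; rewrite lee_fin sqr_ge0.
- by apply/measurable_EFinP; exact: measurable_funX.
- move=> t _; rewrite lee_fin -[f t ^+ 2]ger0_norm ?sqr_ge0// normrX.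
  by rewrite ler_pXn2r ?nnegrE// (le_trans _ (fM t)).
Qed.

Lemma indic_Lfun2 A : measurable A -> \1_A \in L2.
Proof.
move=> mA; apply: (@bounded_Lfun2 _ 1); first exact: measurable_indic.
by move=> t; rewrite indicE; case: (_ \in _); rewrite ?normr1 ?normr0.
Qed.

Lemma Lfun2M f g : f \in L2 -> g \in L2 -> (fun t => f t * g t) \in L1.
Proof. exact: Lfun2_mul_Lfun1. Qed.

Lemma mean_bilinear (m n : nat) (a : 'I_m -> R) (b : 'I_n -> R)
    (F : 'I_m -> T -> R) (G : 'I_n -> T -> R) :
  (forall i, F i \in L2) -> (forall j, G j \in L2) ->
  mean (fun t => (\sum_i a i * F i t) * (\sum_j b j * G j t)) =
  \sum_i \sum_j a i * mean (fun t => F i t * G j t) * b j.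
Proof.
move=> FL GL; under [in LHS]eq_fun do rewrite big_distrlr /=.
have H i j : (fun t => a i * F i t * (b j * G j t)) \in L1.
  by apply: Lfun2M; apply: LfunZ => //; exact: ler1n.
rewrite mean_sum => [|i]; last exact: Lfun_sum.
apply: eq_bigr => i _; rewrite mean_sum//; apply: eq_bigr => j _.
rewrite mulrAC -meanZ; last exact: Lfun2M.
by congr mean; apply/funext => t; ring.
Qed.

Lemma mean_sqr_eq0 f : f \in L2 -> mean (fun t => f t * f t) = 0 ->
  ae_eq P setT f (cst 0).
Proof.
move=> fL f0; have mf := Lfun2_measurable fL.
have : (\int[P]_t `|(f t * f t)%:E| = 0)%E.
  under eq_integral do rewrite /= ger0_norm -?expr2 ?sqr_ge0// expr2.
  by have := meanE (Lfun2M fL fL); rewrite f0 unlock.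
rewrite ae_eq_integral_abs//; last by apply/measurable_EFinP; exact: measurable_funM.
apply: filterS => t /(_ I)/eqP; rewrite eqe mulf_eq0 orbb => /eqP h _.
exact: h.
Qed.

Lemma mean_ae f g : measurable_fun setT f -> measurable_fun setT g ->
  ae_eq P setT f g -> mean f = mean g.
Proof.
move=> mf mg fg; rewrite /mean unlock; congr fine; apply: ae_eq_integral => //.
- exact/measurable_EFinP.
- exact/measurable_EFinP.
- by apply: filterS fg => t /[apply] ->.
Qed.

Lemma measurable_le f x : measurable_fun setT f -> measurable [set t | f t <= x].
Proof.
move=> mf; rewrite -[X in measurable X]setTI.
rewrite (_ : [set t | _] = f @^-1` `]-oo, x]); first exact: mf.
by apply/seteqP; split=> t /=; rewrite in_itv.
Qed.

Lemma pr_le_ae f g x : measurable_fun setT f -> measurable_fun setT g ->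
  ae_eq P setT f g -> pr P [set t | f t <= x] = pr P [set t | g t <= x].
Proof.
move=> mf mg fg; rewrite -!mean_indic; try exact: measurable_le.
apply: mean_ae; try exact/measurable_indic/measurable_le.
apply: filterS fg => t /[apply] fgt; rewrite !indicE.
by congr (nat_of_bool _)%:R; apply/idP/idP; rewrite !inE/= fgt.
Qed.

Lemma covarianceE_mean f g : f \in L2 -> g \in L2 ->
  covariance P f g = (mean (fun t => f t * g t) - mean f * mean g)%:E.
Proof.
move=> fL gL; have [fL1 gL1] := (Lfun2_Lfun1 fL, Lfun2_Lfun1 gL).
by rewrite covarianceE ?Lfun2M// !meanE ?Lfun2M.
Qed.

End mean.

(** * Uniform laws and the probability integral transform *)

Section uniform_law.
Context (disp : measure_display) (T : measurableType disp) (R : realType)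
  (P : probability T R).

Lemma uniform_prob_le (a b x : R) (ab : a < b) : a <= x <= b ->
  uniform_prob ab `]-oo, x] = ((x - a) / (b - a))%:E.
Proof.
move=> /andP[ax xb]; rewrite /uniform_prob integral_uniform_pdf.
have -> : `]-oo, x]%classic `&` `[a, b] = `[a, x]%classic.
  apply/seteqP; split=> t /=; rewrite !in_itv/=.
    by move=> [tx /andP[->]].
  by move=> /andP[at_ tx]; rewrite tx at_ (le_trans tx).
rewrite (eq_integral (fun=> (b - a)^-1%:E)); last first.
  move=> t; rewrite inE/= in_itv/= => /andP[at_ tx].
  by rewrite /uniform_pdf at_ (le_trans tx).
rewrite integral_cst//= lebesgue_measure_itv/= lte_fin.
case: ltP => h; first by rewrite -EFinB -EFinM mulrC.
by rewrite mule0 (_ : x = a) ?subrr ?mul0r//; apply/le_anti/andP.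
Qed.

Lemma cdfE (X : {RV P >-> R}) x : cdf X x = (pr P [set t | X t <= x])%:E.
Proof.
rewrite -prE; last by apply: measurable_le; exact: measurable_funP.
by congr (P _); apply/seteqP; split=> t /=; rewrite in_itv.
Qed.

(* [measurableTypeR R], on which [uniform_prob] lives, and the canonical
   measurable structure of [R] have the same measurable sets but different
   displays. *)
Lemma law_ex (X : {RV P >-> R}) : exists Q : probability (measurableTypeR R) R,
  (forall B, distribution P X B = Q B) /\
  (forall f : R -> \bar R, measurable_fun setT f -> (forall y, 0 <= f y)%E ->
     \int[Q]_y f y = \int[P]_t f (X t))%E.
Proof.
have mX : measurable_fun setT (X : T -> measurableTypeR R) := measurable_funP X.
pose X' := @mfun_Sub _ _ T (measurableTypeR R) X (mem_set mX).
exists (distribution P X'); split=> // f mf f0.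
by rewrite ge0_integral_distribution.
Qed.

(** The half-lines []x, +oo[] generate the Borel sets and are closed under intersection, so the
    distribution function determines the law. Outside [a, b], monotonicity forces its values 0 and
    1. *)
Lemma uniform_rvP (a b : R) (ab : a < b) (X : {RV P >-> R}) :
  uniform_rv P ab X <->
  forall x, a <= x <= b -> pr P [set t | X t <= x] = (x - a) / (b - a).
Proof.
split=> [h x axb|h].
  by apply: EFin_inj; rewrite -cdfE /cdf h// uniform_prob_le.
have [Q [XQ _]] := law_ex X.
have mu_le (x : R) : Q `]-oo, x]%classic = uniform_prob ab `]-oo, x].
  have ba : 0 < b - a by rewrite subr_gt0.
  have mono (Q' : probability (measurableTypeR R) R) (y z : R) : y <= z ->
      (Q' `]-oo, y]%classic <= Q' `]-oo, z]%classic)%E.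
    by move=> yz; rewrite le_measure ?inE//; exact: subitvPr.
  have val y : a <= y <= b -> Q `]-oo, y]%classic = ((y - a) / (b - a))%:E.
    by move=> /h <-; rewrite -cdfE /cdf XQ.
  have [xa|ax] := ltP x a.
    have aab : a <= a <= b by rewrite lexx ltW.
    have z (Q' : probability (measurableTypeR R) R) :
        Q' `]-oo, a]%classic = 0%E -> Q' `]-oo, x]%classic = 0%E.
      move=> Q'0; apply/eqP; rewrite eq_le measure_ge0 andbT -Q'0.
      exact/mono/ltW.
    have -> : Q `]-oo, x]%classic = 0%E by apply: z; rewrite val// subrr mul0r.
    apply/esym/z; apply: etrans (uniform_prob_le ab aab) _.
    by rewrite subrr mul0r.
  have [bx|xb] := ltP b x.
    have abb : a <= b <= b by rewrite lexx ltW.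
    have z (Q' : probability (measurableTypeR R) R) :
        Q' `]-oo, b]%classic = 1%E -> Q' `]-oo, x]%classic = 1%E.
      move=> Q'1; apply/eqP; rewrite eq_le probability_le1//= -Q'1.
      exact/mono/ltW.
    have -> : Q `]-oo, x]%classic = 1%E.
      by apply: z; rewrite val// divff ?gt_eqF.
    apply/esym/z; apply: etrans (uniform_prob_le ab abb) _.
    by rewrite divff ?gt_eqF.
  by rewrite val ?ax// uniform_prob_le ?ax.
move=> B mB; rewrite XQ.
pose g (k : nat) : set R := `]- k%:R, +oo[%classic.
apply: (@measure_unique _ R (measurableTypeR R) (@RGenOInfty.G R) g _ _ _ _ Q
  (uniform_prob ab)) => //.
- exact: RGenOInfty.measurableE.
- move=> _ _ [x ->] [y ->]; exists (Num.max x y).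
  by apply/seteqP; split=> t /=; rewrite !in_itv/= !andbT gt_max => /andP.
- by move=> k; exists (- k%:R).
- rewrite -subTset => t _; exists (Num.bound `|t : R|) => //.
  have : - (t : R) < (Num.bound `|t : R|)%:R.
    by rewrite (le_lt_trans (ler_norm _))// normrN archi_boundP.
  by rewrite /g/= in_itv/= andbT ltrNl.
- have setC (Q' : probability (measurableTypeR R) R) (x : R) :
      Q' `]x, +oo[%classic = (1 - Q' `]-oo, x]%classic)%E.
    by rewrite -setCitvl probability_setC.
  move=> _ [x ->]; apply: etrans (setC Q x) _; rewrite mu_le.
  exact/esym/(setC (uniform_prob ab)).
- move=> k; apply: (@le_lt_trans _ _ 1%E); last exact: ltry.
  by apply: probability_le1; exact: measurable_itv.
Qed.

(** The bounds hold at every point, not just almost surely, so that boundedness and binary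
    expansions are available pointwise. *)
Definition unif01 (Z : T -> R) := [/\ measurable_fun setT Z,
  forall t, 0 <= Z t <= 1 &
  forall x, 0 <= x <= 1 -> pr P [set t | Z t <= x] = x].

Lemma unif01_Lfun2 Z : unif01 Z -> Z \in Lfun P 2%:E.
Proof.
move=> [mZ Z01 _]; apply: (@bounded_Lfun2 _ _ _ _ _ 1) => // t.
by have /andP[Z0 Z1] := Z01 t; rewrite ger0_norm.
Qed.

Lemma mfun_ex (f : T -> R) : measurable_fun setT f ->
  exists X : {RV P >-> R}, X = f :> (T -> R).
Proof. by move=> mf; exists (mfun_Sub (mem_set mf)). Qed.

Let unif01_moment Z n : unif01 Z -> mean P (fun t => (1 - Z t) ^+ n) = n.+1%:R^-1.
Proof.
move=> [mZ Z01 PZ]; have [X XZ] := mfun_ex mZ.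
have [Q [XQ intQ]] := law_ex X.
have lawX : uniform_rv P (ltr01 : (0 : R) < 1) X.
  by apply/uniform_rvP => x x01; rewrite XZ PZ// !subr0 divr1.
rewrite -Rintegral_onemXn /mean unlock /Rintegral; congr fine.
(* The absolute value makes the integrand nonnegative on the whole line, as the change of variables
   [intQ] demands; on [0, 1] it has no effect. *)
pose f (x : R) : \bar R := (`|(1 - x) ^+ n|)%:E.
have mf : measurable_fun setT f.
  apply/measurable_EFinP; apply: measurableT_comp => //.
  by apply: measurable_funX; exact: measurable_funB.
have f0 x : (0 <= f x)%E by rewrite lee_fin.
transitivity (\int[P]_t (f \o X) t)%E.
  apply: eq_integral => t _; rewrite /f/= XZ ger0_norm// exprn_ge0//.
  by have /andP[_] := Z01 t; rewrite subr_ge0.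
rewrite -intQ//.
rewrite [LHS](eq_measure_integral (uniform_prob (ltr01 : (0 : R) < 1))); last first.
  by move=> B mB _; apply: etrans (esym (XQ B)) _; exact: lawX.
rewrite integral_uniform// subr0 invr1 mul1e; apply: eq_integral => x.
rewrite inE/= in_itv/= => /andP[x0 x1].
by rewrite /f ger0_norm// exprn_ge0// subr_ge0.
Qed.

Lemma mean_unif01 Z : unif01 Z -> mean P Z = 2^-1.
Proof.
move=> uZ; have ZL := Lfun2_Lfun1 (unif01_Lfun2 uZ).
have := unif01_moment 1 uZ; rewrite -[fun _ => _ ^+ 1]/(fun t => 1 - Z t).
by rewrite meanB ?Lfun1_cst// mean_cst; lra.
Qed.

Lemma mean_sqr_unif01 Z : unif01 Z -> mean P (fun t => Z t * Z t) = 3^-1.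
Proof.
move=> uZ; have ZL2 := unif01_Lfun2 uZ; have ZL := Lfun2_Lfun1 ZL2.
have := unif01_moment 2 uZ.
have -> : (fun t => (1 - Z t) ^+ 2) = (fun t => (1 + - 2 * Z t) + Z t * Z t).
  by apply/funext => t; ring.
have L1c := Lfun1_cst P (1 : R).
rewrite meanD ?Lfun2M ?LfunD ?LfunZ// meanD ?LfunZ// meanZ// mean_cst mean_unif01//.
lra.
Qed.

(** The uniform law on [0, 1] has mean 1/2 and variance 1/12, which is the denominator of Pearson's
    coefficient. *)
Lemma spearman_unif01 (X Y : {RV P >-> R}) :
  unif01 (cdf_transform X) -> unif01 (cdf_transform Y) ->
  spearman X Y =
  12 * mean P (fun t => cdf_transform X t * cdf_transform Y t) - 3.
Proof.
move=> uX uY; rewrite /spearman /pearson /variance !covarianceE_mean ?unif01_Lfun2//.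
rewrite /= (mean_unif01 uX) (mean_unif01 uY) (mean_sqr_unif01 uX) (mean_sqr_unif01 uY).
rewrite -[Num.sqrt _ * _]expr2 sqr_sqrtr; last lra.
have -> : 3^-1 - 2^-1 * 2^-1 = 12^-1 :> R by field.
by field.
Qed.

(** By the intermediate value theorem [F] takes every value of ]0, 1[. By monotonicity [X t <= x]
    gives [F (X t) <= F x], and [F (X t) < F x] gives [X t <= x]. *)
Lemma unif01_cdf_transform (X : {RV P >-> R}) : continuous (cdf X) ->
  unif01 (cdf_transform X).
Proof.
move=> cX; pose F x := pr P [set t | X t <= x].
have FE : cdf_transform X = F \o X.
  by apply/funext => t; rewrite /cdf_transform cdfE.
have mX : measurable_fun setT X by exact: measurable_funP.
have mle x : measurable [set t | X t <= x] by exact: measurable_le.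
have F_nd x y : x <= y -> F x <= F y.
  by move=> xy; apply: pr_le => // t /= /le_trans; apply.
have mF : measurable_fun setT (cdf_transform X).
  rewrite FE; apply: measurableT_comp => //.
  by apply: nondecreasing_measurable => // x y _ _; exact: F_nd.
have cF : continuous F.
  move=> x; have : cdf X y @[y --> x] --> (F x)%:E by rewrite /F -cdfE; exact: cX.
  by move=> /fine_cvg; apply: cvg_trans; apply: near_eq_cvg;
    apply: nearW => y; rewrite /= cdfE.
have F_onto u : 0 < u < 1 -> exists x, F x = u.
  move=> /andP[u0 u1].
  have [a Fa] : exists a, F a < u.
    have /fine_cvg/cvgrPdist_lt/(_ u u0) := cvg_cdfNy0 X.
    move=> [M [_ /(_ (M - 1))]]; rewrite ltrBlDr ltrDl ltr01 => /(_ isT) /=.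
    by rewrite cdfE/= sub0r normrN ger0_norm ?pr_ge0// => ?; exists (M - 1).
  have [b Fb] : exists b, u < F b.
    have u1' : 0 < 1 - u by lra.
    have /fine_cvg/cvgrPdist_lt/(_ _ u1') := cvg_cdfy1 X.
    move=> [M [_ /(_ (M + 1))]]; rewrite ltrDl ltr01 => /(_ isT) /=.
    rewrite cdfE/= ltr_norml => /andP[_ h]; exists (M + 1).
    by move: h; rewrite -/(F _); lra.
  have ab : a <= b.
    by rewrite leNgt; apply/negP => /ltW/F_nd; lra.
  have [|c _ Fc] := @IVT R F a b u ab (continuous_subspaceT cF); last by exists c.
  by rewrite ge_min le_max (ltW Fa) (ltW Fb) orbT.
split=> //.
  by move=> t; rewrite FE /F/= pr_ge0 pr_le1.
have mFle u : measurable [set t | cdf_transform X t <= u] by exact: measurable_le.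
(* [F] may be flat, so [F (X t) <= F x] does not bound [X t]; a value [v] slightly above [u] and
   below 1 yields the strict inequality. *)
have le_u u : 0 <= u < 1 -> pr P [set t | cdf_transform X t <= u] <= u.
  move=> /andP[u0 u1]; apply/ler_addgt0Pr => e e0.
  pose v := u + Num.min e ((1 - u) / 2).
  have uv : u < v by rewrite /v ltrDl lt_min e0/= divr_gt0//; lra.
  have ve : v <= u + e by rewrite /v lerD2l ge_min lexx.
  have v1 : v < 1.
    have : v <= u + (1 - u) / 2 by rewrite /v lerD2l ge_min lexx orbT.
    lra.
  have [|x Fx] := F_onto v; first by rewrite v1 andbT; lra.
  rewrite (le_trans _ ve)// -Fx; apply: pr_le => // t /=.
  by rewrite FE /= => FXu; rewrite leNgt; apply/negP => /ltW/F_nd; lra.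
move=> u /andP[u0 u1]; apply/eqP; rewrite eq_le; apply/andP; split.
  have [u1'|] := ltP u 1; first by apply: le_u; rewrite u0.
  by move=> /(le_trans (pr_le1 _ (mFle u))).
have [->|un0] := eqVneq u 0; first exact: pr_ge0.
have [u_lt1|u_ge1] := ltP u 1.
  have [|x Fx] := F_onto u; first by rewrite u_lt1 andbT lt_neqAle eq_sym un0.
  rewrite -{1}Fx; apply: pr_le => // t /= /F_nd.
  by rewrite FE /= Fx.
rewrite (_ : [set t | _] = setT) ?pr_setT//; apply/seteqP; split=> // t _ /=.
by rewrite (le_trans _ u_ge1)// FE /F/= pr_le1.
Qed.

Lemma cdf_unif01 (Z : {RV P >-> R}) x : unif01 Z ->
  cdf Z x = (Num.max 0 (Num.min x 1))%:E.
Proof.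
move=> [mZ Z01 PZ]; rewrite cdfE; congr EFin.
have [x0|x0] := leP 0 x; last first.
  rewrite (_ : [set t | _] = set0) /pr ?measure0.
    by rewrite max_l// ge_min ltW.
  apply/seteqP; split=> // t /= h; have /andP[] := Z01 t; lra.
have [x1|x1] := leP x 1.
  by rewrite PZ ?x0// max_r.
rewrite (_ : [set t | _] = setT) ?pr_setT; first by rewrite max_r// ler01.
by apply/seteqP; split=> // t _ /=; have /andP[_] := Z01 t; lra.
Qed.

Lemma cdf_transform_unif01 (Z : {RV P >-> R}) : unif01 Z -> cdf_transform Z = Z.
Proof.
move=> uZ; apply/funext => t; rewrite /cdf_transform cdf_unif01//=.
by have [_ /(_ t)/andP[Z0 Z1] _] := uZ; rewrite min_l// max_r.
Qed.

Lemma continuous_cdf_unif01 (Z : {RV P >-> R}) : unif01 Z -> continuous (cdf Z).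
Proof.
move=> uZ; rewrite (_ : cdf Z = EFin \o (fun x => Num.max 0 (Num.min x 1))); last first.
  by apply/funext => x; exact: cdf_unif01.
move=> x; apply: cvg_EFin; first exact: nearW.
apply: (@continuous_max R R (fun=> 0) (fun x => Num.min x 1)).
  exact: cst_continuous.
apply: (@continuous_min R R (fun x => x) (fun=> 1)); first exact: cvg_id.
exact: cst_continuous.
Qed.

End uniform_law.

(** * Mixtures of laws with uniform marginals *)

Section binary_expansion.
Variable R : realType.
Implicit Types (x : R) (s : nat -> bool).

Definition dyadic n s : R := \sum_(l < n) (s l)%:R * 2^-1 ^+ l.+1.

Lemma dyadicS n s : dyadic n.+1 s = dyadic n s + (s n)%:R * 2^-1 ^+ n.+1.
Proof. by rewrite /dyadic big_ord_recr. Qed.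

Lemma halfX_gt0 n : 0 < 2^-1 ^+ n :> R.
Proof. by rewrite exprn_gt0// invr_gt0. Qed.

Lemma halfXS n : 2^-1 ^+ n.+1 + 2^-1 ^+ n.+1 = 2^-1 ^+ n :> R.
Proof. by rewrite exprS; field. Qed.

(** Each further digit keeps the left or the right half of the current dyadic interval, so these
    intervals are nested. *)
Lemma dyadic_le m n s : (m <= n)%N ->
  dyadic m s <= dyadic n s /\ dyadic n s + 2^-1 ^+ n <= dyadic m s + 2^-1 ^+ m.
Proof.
move=> /subnK <-; elim: (n - m)%N => [|k [IH1 IH2]] //=.
rewrite addSn dyadicS; have := halfX_gt0 (k + m).+1; have := halfXS (k + m).
by case: (s _) => /=; rewrite ?mul1r ?mul0r; lra.
Qed.

(* The number in [0, 1] with binary digits [s]. *)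
Definition binval s : R := sup (range (dyadic^~ s)).

Lemma binval_bound n s : dyadic n s <= binval s <= dyadic n s + 2^-1 ^+ n.
Proof.
have ub m k : dyadic m s <= dyadic k s + 2^-1 ^+ k.
  have [mk|/ltnW km] := leqP m k.
    by have [] := dyadic_le s mk; have := halfX_gt0 k; lra.
  by have [] := dyadic_le s km; have := halfX_gt0 m; lra.
have hs : has_sup (range (dyadic^~ s)).
  split; first by exists (dyadic 0 s), 0%N.
  by exists (dyadic 0 s + 2^-1 ^+ 0) => _ [m _ <-].
apply/andP; split; first by apply: sup_upper_bound => //; exists n.
by apply: ge_sup => [|_ [m _ <-]//]; case: hs.
Qed.

(* The greedy binary digits of [x], which are all 1 for [x = 1]. *)
Fixpoint dyadic_part n x : R := if n is n'.+1 then
  dyadic_part n' x + (dyadic_part n' x + 2^-1 ^+ n <= x)%R%:R * 2^-1 ^+ n else 0.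

Definition bit n x := dyadic_part n x + 2^-1 ^+ n.+1 <= x.

Lemma dyadic_bit n x : dyadic n (bit^~ x) = dyadic_part n x.
Proof.
by elim: n => [|n IH]; rewrite ?dyadicS ?IH//= /dyadic big_ord0.
Qed.

Lemma dyadic_part_bound n x : 0 <= x <= 1 ->
  dyadic_part n x <= x <= dyadic_part n x + 2^-1 ^+ n.
Proof.
move=> x01; elim: n => [|n IH]; first by rewrite add0r expr0.
rewrite [dyadic_part _ _]/=; have := halfXS n.
case: (leP (dyadic_part n x + 2^-1 ^+ n.+1) x) => /=; rewrite ?mul1r ?mul0r; lra.
Qed.

Lemma dyadic_ge0 n s : 0 <= dyadic n s.
Proof. by rewrite sumr_ge0// => l _; rewrite mulr_ge0// ltW// halfX_gt0. Qed.

Lemma measurable_dyadic_part n : measurable_fun setT (dyadic_part n).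
Proof.
elim: n => [|n IH]; first exact: measurable_cst.
apply: measurable_funD => //; apply: measurable_funM; last exact: measurable_cst.
rewrite (_ : (fun _ => _) = \1_[set x | dyadic_part n x + 2^-1 ^+ n.+1 <= x]).
  apply: measurable_indic; rewrite -[X in measurable X]setTI.
  by apply: measurable_fun_le => //; exact: measurable_funD.
by apply/funext => x; rewrite indicE mem_setE.
Qed.

Lemma measurable_bit n : measurable [set x | bit n x].
Proof.
rewrite -[X in measurable X]setTI; apply: measurable_fun_le => //.
by apply: measurable_funD => //; exact: measurable_dyadic_part.
Qed.

End binary_expansion.

Section word_mean.
Context (disp : measure_display) (T : measurableType disp) (R : realType)
  (P : probability T R).
Variable D : nat -> T -> bool.
Hypothesis mD : forall n, measurable [set t | D n t].

(** A function of the first [n] digits is constant on cylinders, so its mean depends only on the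
    cylinder probabilities, which a mixture prescribes. *)
Let word_funE n (g : seq bool -> R) : (fun t => g (mkseq (D^~ t) n)) =
  (fun t => \sum_(w : n.-tuple bool) g w * \1_(cylinder D w) t).
Proof.
apply/funext => t.
rewrite (bigD1 (Tuple (introT eqP (size_mkseq (D^~ t) n))))//= big1 ?addr0.
  by rewrite indicE mem_set ?mulr1// /cylinder/= size_mkseq.
move=> w wt; rewrite indicE memNset ?mulr0// /cylinder/= size_tuple => h.
by case/eqP: wt; exact/val_inj.
Qed.

Lemma word_Lfun2 n (g : seq bool -> R) : (fun t => g (mkseq (D^~ t) n)) \in Lfun P 2%:E.
Proof.
rewrite word_funE; apply: Lfun_sum => [|w]; first by rewrite ler1n.
by apply: LfunZ; [rewrite ler1n | exact/indic_Lfun2/measurable_cylinder].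
Qed.

Lemma word_mean n (g : seq bool -> R) : mean P (fun t => g (mkseq (D^~ t) n)) =
  \sum_(w : n.-tuple bool) g w * pr P (cylinder D w).
Proof.
have L1 w : \1_(cylinder D w) \in Lfun P 1.
  exact/Lfun2_Lfun1/indic_Lfun2/measurable_cylinder.
rewrite word_funE mean_sum => [|w]; last exact: LfunZ.
apply: eq_bigr => w _; rewrite meanZ// mean_indic//.
exact: measurable_cylinder.
Qed.

End word_mean.

(** * Correlation matrices of uniform variables and their convexity *)

Section uniform_gram.
Context (disp : measure_display) (T : measurableType disp) (R : realType)
  (P : probability T R).

Definition uniform_gram d : set 'M[R]_d := [set M | exists Z : 'I_d -> {RV P >-> R},
  (forall i, unif01 P (Z i)) /\
  forall i j, M i j = 12 * mean P (fun t => Z i t * Z j t) - 3].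

Arguments uniform_gram d : clear implicits.

(** One inclusion is the probability integral transform; for the other, a uniform variable on [0, 1]
    is its own transform. *)
Lemma spearman_uniform_gram d : spearman_set P d = uniform_gram d.
Proof.
apply/seteqP; split=> M [X [uX MX]].
  have uZ i : unif01 P (cdf_transform (X i)) by exact: unif01_cdf_transform.
  have /choice[Z ZE] : forall i, exists Y : {RV P >-> R},
      Y = cdf_transform (X i) :> (T -> R).
    by move=> i; have [mZ _ _] := uZ i; exact: mfun_ex.
  exists Z; split=> [i|i j]; first by rewrite ZE.
  by rewrite MX mxE !ZE spearman_unif01.
exists X; split=> [i|]; first exact: continuous_cdf_unif01.
apply/matrixP => i j; rewrite mxE MX spearman_unif01 ?cdf_transform_unif01//.
Qed.

Lemma uniform_gram_psd d : uniform_gram d `<=` psd_corr_set R d.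
Proof.
move=> M [Z [uZ MZ]]; split.
- by apply/matrixP => i j; rewrite mxE !MZ; congr (_ * mean P _ - _);
    apply/funext => t; rewrite mulrC.
- move=> x; pose Y i t := Z i t - 2^-1.
  have L1Z i : (Z i : T -> R) \in Lfun P 1 by exact/Lfun2_Lfun1/unif01_Lfun2.
  have L2Y i : Y i \in Lfun P 2%:E.
    apply: LfunD; first by rewrite ler1n.
      exact: unif01_Lfun2.
    exact: Lfun_cst.
  (* After centring, [M] is 12 times a covariance matrix, so its quadratic form is 12 times the mean
     of a square. *)
  have MY i j : M i j = 12 * mean P (fun t => Y i t * Y j t).
    rewrite MZ (_ : (fun t => Y i t * Y j t) =
      (fun t => Z i t * Z j t + (- 2^-1 * Z i t + (- 2^-1 * Z j t + 4^-1)))).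
      have L2Z k : (Z k : T -> R) \in Lfun P 2%:E by exact: unif01_Lfun2.
      rewrite meanD ?Lfun2M ?LfunD ?LfunZ ?Lfun1_cst//.
      rewrite meanD ?LfunD ?LfunZ ?Lfun1_cst// meanD ?LfunZ ?Lfun1_cst//.
      by rewrite !meanZ// mean_cst (mean_unif01 (uZ i)) (mean_unif01 (uZ j)); field.
    by apply/funext => t; rewrite /Y; field.
  have := mean_bilinear (fun i => x i 0) (fun i => x i 0) L2Y L2Y.
  set m := mean P _; have m0 : 0 <= m.
    by apply: mean_ge0 => t; rewrite -expr2 sqr_ge0.
  move=> mE; suff -> : (x^T *m M *m x) 0 0 = 12 * m by rewrite mulr_ge0.
  rewrite mE mxE exchange_big/= mulr_sumr; apply: eq_bigr => i _.
  rewrite mxE mulr_suml mulr_sumr; apply: eq_bigr => j _.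
  by rewrite mxE MY; ring.
- by move=> i; rewrite MZ mean_sqr_unif01//; field.
Qed.

(** This bound and the next remain valid beyond [0, 1] on one side, where the shifted thresholds
    [x + e] and [x - e] may fall. *)
Lemma unif01_le Z x : unif01 P Z -> 0 <= x -> pr P [set t | Z t <= x] <= x.
Proof.
move=> [mZ Z01 PZ] x0; have [x1|/ltW x1] := leP x 1; first by rewrite PZ ?x0.
by rewrite (le_trans _ x1)// pr_le1//; exact: measurable_le.
Qed.

Lemma unif01_ge Z x : unif01 P Z -> x <= 1 -> x <= pr P [set t | Z t <= x].
Proof.
move=> [mZ Z01 PZ] x1; have [x0|/ltW x0] := leP 0 x; first by rewrite PZ ?x0.
by rewrite (le_trans x0)// pr_ge0.
Qed.

Lemma eq_halfX (a b c : R) : (forall n, `|a - b| <= c * 2^-1 ^+ n) -> a = b.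
Proof.
move=> h; apply/eqP; rewrite -subr_eq0 -normr_le0.
have : (fun n => c * 2^-1 ^+ n) @ \oo --> (c * 0 : R).
  apply: cvgM; first exact: cvg_cst.
  by apply: cvg_expr; rewrite ger0_norm; lra.
rewrite mulr0 => cv; rewrite -(cvg_lim _ cv)//; apply: limr_ge.
  by apply/cvg_ex; exists 0.
exact: nearW.
Qed.

Hypothesis hP : atomless P.

(* Mixtures of laws on the cube: the binary digits of the coordinates,
   interleaved into one sequence of bits, are given the mixed law. *)
Lemma uniform_gram_convex d (M N : 'M[R]_d) (a : R) : (0 < d)%N -> 0 <= a <= 1 ->
  uniform_gram d M -> uniform_gram d N -> uniform_gram d (a *: M + (1 - a) *: N).
Proof.
move=> d0 a01 [Y [uY MY]] [Z [uZ NZ]].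
(* Interleaving: position [n] carries digit [n %/ d] of the coordinate [n %% d]. *)
pose B (X : 'I_d -> {RV P >-> R}) n t :=
  bit (n %/ d) (X (Ordinal (ltn_pmod n d0)) t).
have mB X n : measurable [set t | B X n t].
  rewrite -[X in measurable X]setTI.
  have mX := measurable_funP (X (Ordinal (ltn_pmod n d0))).
  exact: (mX setT measurableT _ (@measurable_bit R (n %/ d))).
pose p w := a * pr P (cylinder (B Y) w) + (1 - a) * pr P (cylinder (B Z) w).
have [||w|D [mD Dp]] := @random_bits _ _ _ P hP p.
- by rewrite /p !cylinder_nil pr_setT; ring.
- by move=> w; rewrite addr_ge0// mulr_ge0// ?pr_ge0//; lra.
- by rewrite /p (pr_cylinder P (mB Y)) (pr_cylinder P (mB Z)); ring.
(* Every mean of a function of finitely many digits is mixed exactly; the rest is approximation by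
   truncation. *)
have mix n g : mean P (fun t => g (mkseq (D^~ t) n)) =
    a * mean P (fun t => g (mkseq (B Y ^~ t) n)) +
    (1 - a) * mean P (fun t => g (mkseq (B Z ^~ t) n)).
  rewrite !word_mean// !mulr_sumr -big_split; apply: eq_bigr => w _ /=.
  by rewrite Dp /p; ring.
(* The truncation to [m] binary digits of coordinate [i], read from an interleaved word of length
   [m * d]. *)
pose G m (i : 'I_d) w := @dyadic R m (fun l => nth false w (l * d + i)).
have idx m l (i : 'I_d) : (l < m)%N -> (l * d + i < m * d)%N.
  move=> lm; rewrite (@leq_trans (l.+1 * d)) ?leq_mul2r ?lm ?orbT//.
  by rewrite mulSn addnC ltn_add2r.
have GE (C : nat -> T -> bool) m i t :
    G m i (mkseq (C^~ t) (m * d)) = dyadic R m (fun l => C (l * d + i)%N t).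
  by apply: eq_bigr => l _; rewrite nth_mkseq// idx.
have GB X m i t : G m i (mkseq (B X ^~ t) (m * d)) = dyadic_part m (X i t).
  rewrite GE -dyadic_bit; apply: eq_bigr => l _; congr ((nat_of_bool _)%:R * _).
  rewrite /B divnMDl// divn_small// addn0; congr (bit _ (X _ t)).
  by apply/val_inj; rewrite /= modnMDl modn_small.
pose W (i : 'I_d) t := binval R (fun l => D (l * d + i)%N t).
have WG m i t : G m i (mkseq (D^~ t) (m * d)) <= W i t <=
    G m i (mkseq (D^~ t) (m * d)) + 2^-1 ^+ m.
  by rewrite GE; exact: binval_bound.
have XG (X : 'I_d -> {RV P >-> R}) m i t : unif01 P (X i) ->
    G m i (mkseq (B X ^~ t) (m * d)) <= X i t <=
    G m i (mkseq (B X ^~ t) (m * d)) + 2^-1 ^+ m.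
  by move=> [_ X01 _]; rewrite GB; exact: dyadic_part_bound.
have G0 m (i : 'I_d) w : 0 <= G m i w by exact: dyadic_ge0.
have W01 (i : 'I_d) t : 0 <= W i t <= 1.
  by have := WG 0%N i t; rewrite /G /dyadic big_ord0 add0r expr0.
have mG (C : nat -> T -> bool) m i : (forall n, measurable [set t | C n t]) ->
    measurable_fun setT (fun t => G m i (mkseq (C^~ t) (m * d))).
  by move=> mC; have := word_Lfun2 P mC (m * d) (G m i); exact: Lfun2_measurable.
have mW i : measurable_fun setT (W i).
  apply: (@measurable_fun_cvg _ _ _ setT
    (fun m t => G m i (mkseq (D^~ t) (m * d)))) => [m|t _]; first exact: mG.
  apply/cvgrPdist_le => e e0; near=> m.
  rewrite (@le_trans _ _ (2^-1 ^+ m))//.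
    by have /andP[h1 h2] := WG m i t; rewrite ger0_norm ?subr_ge0// lerBlDl.
  near: m.
  have : (fun n => 2^-1 ^+ n : R) @ \oo --> (0 : R).
    by apply: cvg_expr; rewrite ger0_norm; lra.
  move=> /cvgrPdist_le/(_ e e0); apply: filterS => m.
  by rewrite sub0r normrN ger0_norm// ltW// halfX_gt0.
have Gpr (C : nat -> T -> bool) m i x : (forall n, measurable [set t | C n t]) ->
    mean P (fun t => (G m i (mkseq (C^~ t) (m * d)) <= x)%R%:R) =
    pr P [set t | G m i (mkseq (C^~ t) (m * d)) <= x].
  move=> mC; rewrite -mean_indic; last exact/measurable_le/mG.
  by congr mean; apply/funext => t; rewrite indicE mem_setE.
have Gmix m i x : pr P [set t | G m i (mkseq (D^~ t) (m * d)) <= x] =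
    a * pr P [set t | G m i (mkseq (B Y^~ t) (m * d)) <= x] +
    (1 - a) * pr P [set t | G m i (mkseq (B Z^~ t) (m * d)) <= x].
  by rewrite -!Gpr// (mix _ (fun w => (G m i w <= x)%R%:R)).
have uW i : unif01 P (W i).
  (* Truncation moves a value by at most [2^-1 ^+ m], so distribution functions are compared at
     thresholds shifted by that amount. *)
  split=> // x x01; apply: (@eq_halfX _ _ 1) => m; rewrite mul1r.
  have e0 := halfX_gt0 R m; set e := 2^-1 ^+ m in e0 *.
  have up (X : 'I_d -> {RV P >-> R}) : unif01 P (X i) ->
      pr P [set t | G m i (mkseq (B X^~ t) (m * d)) <= x] <= x + e.
    move=> uX; apply: le_trans (unif01_le uX _); last lra.
    apply: pr_le => [||t /=]; [exact/measurable_le/mG|exact: measurable_le|].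
    by have := XG X m i t uX; rewrite -/e; lra.
  have lo (X : 'I_d -> {RV P >-> R}) : unif01 P (X i) ->
      x - e <= pr P [set t | G m i (mkseq (B X^~ t) (m * d)) <= x - e].
    move=> uX; apply: (le_trans (unif01_ge uX _)); first lra.
    apply: pr_le => [||t /=]; [exact: measurable_le|exact/measurable_le/mG|].
    by have := XG X m i t uX; rewrite -/e; lra.
  have Wup : pr P [set t | W i t <= x] <=
      pr P [set t | G m i (mkseq (D^~ t) (m * d)) <= x].
    apply: pr_le => [||t /=]; [exact: measurable_le|exact/measurable_le/mG|].
    by have := WG m i t; lra.
  have Wlo : pr P [set t | G m i (mkseq (D^~ t) (m * d)) <= x - e] <=
      pr P [set t | W i t <= x].
    apply: pr_le => [||t /=]; [exact/measurable_le/mG|exact: measurable_le|].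
    by have := WG m i t; rewrite -/e; lra.
  rewrite Gmix in Wup; rewrite Gmix in Wlo.
  have := (up _ (uY i), up _ (uZ i), (lo _ (uY i), lo _ (uZ i))).
  case=> -[u1 u2] [l1 l2]; rewrite ler_norml; apply/andP; split; nra.
have /choice[W' W'E] : forall i, exists X : {RV P >-> R}, X = W i :> (T -> R).
  by move=> i; exact: mfun_ex.
exists W'; split=> [i|i j]; first by rewrite W'E.
rewrite !W'E 2!mxE [(_ *: N) _ _]mxE MY NZ.
suff -> : mean P (fun t => W i t * W j t) = a * mean P (fun t => Y i t * Y j t) +
  (1 - a) * mean P (fun t => Z i t * Z j t) by ring.
apply: (@eq_halfX _ _ 2) => m.
have e0 := halfX_gt0 R m; set e := 2^-1 ^+ m in e0 *.
pose g w := G m i w * G m j w.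
(* Both factors lie in [0, 1] and each truncation loses at most [e], so the product loses at most
   [2 * e]. *)
have sandwich (C : nat -> T -> bool) (X : 'I_d -> T -> R) :
    (forall n, measurable [set t | C n t]) -> (forall i, unif01 P (X i)) ->
    (forall i t, G m i (mkseq (C^~ t) (m * d)) <= X i t <=
      G m i (mkseq (C^~ t) (m * d)) + e) ->
    mean P (fun t => g (mkseq (C^~ t) (m * d))) <= mean P (fun t => X i t * X j t)
      <= mean P (fun t => g (mkseq (C^~ t) (m * d))) + 2 * e.
  move=> mC uX CX.
  have L1XX : (fun t => X i t * X j t) \in Lfun P 1.
    by apply: Lfun2M; exact: unif01_Lfun2.
  have L1g : (fun t => g (mkseq (C^~ t) (m * d))) \in Lfun P 1.
    exact/Lfun2_Lfun1/word_Lfun2.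
  apply/andP; split.
    apply: le_mean => // t; rewrite /g.
    by apply: ler_pM => //; [have := CX i t | have := CX j t]; lra.
  rewrite -[2 * e](mean_cst P) -meanD//; last exact: Lfun1_cst.
  apply: le_mean => // [|t]; first by apply: LfunD => //; exact: Lfun1_cst.
  have := (CX i t, CX j t,
    (G0 m i (mkseq (C^~ t) (m * d)), G0 m j (mkseq (C^~ t) (m * d)))).
  have [[_ /(_ t) Xi _] [_ /(_ t) Xj _]] := (uX i, uX j).
  rewrite /g; move: (G m i _) (G m j _) => gi gj [[hi hj] [gi0 gj0]].
  have : (X i t - gi) * X j t <= e * 1 by apply: ler_pM; lra.
  have : gi * (X j t - gj) <= 1 * e by apply: ler_pM; lra.
  lra.
have sW := sandwich D W mD uW (WG m).
have sY := sandwich _ _ (mB Y) uY (fun k t => XG Y m k t (uY k)).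
have sZ := sandwich _ _ (mB Z) uZ (fun k t => XG Z m k t (uZ k)).
rewrite mix in sW; rewrite ler_norml; apply/andP; split; nra.
Unshelve. all: by end_near. Qed.

End uniform_gram.
Arguments uniform_gram {disp T R} P d.

(** * Orthonormal random variables and the theorem *)

Section orthonormal.
Context (disp : measure_display) (T : measurableType disp) (R : realType)
  (P : probability T R).
Local Notation L2 := (Lfun P 2%:E).

Lemma mean_suml n (a : 'I_n -> R) (F : 'I_n -> T -> R) g :
  (forall i, F i \in L2) -> g \in L2 ->
  mean P (fun t => (\sum_i a i * F i t) * g t) =
  \sum_i a i * mean P (fun t => F i t * g t).
Proof.
move=> FL gL; have := mean_bilinear a (fun _ : 'I_1 => 1) FL (fun _ : 'I_1 => gL).
under eq_fun do rewrite big_ord1 mul1r.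
by move=> ->; apply: eq_bigr => i _; rewrite big_ord1 mulr1.
Qed.

Lemma mean_gram m n (B : 'M[R]_(m, n)) (F : 'I_n -> T -> R) (G : 'M[R]_n) :
  (forall i, F i \in L2) -> (forall i j, mean P (fun t => F i t * F j t) = G i j) ->
  forall i j, mean P (fun t => (\sum_l B i l * F l t) * (\sum_l B j l * F l t)) =
    (B *m G *m B^T) i j.
Proof.
move=> FL FG i j; rewrite mean_bilinear// mxE exchange_big; apply: eq_bigr => l _.
rewrite [X in X * _]mxE [X in _ * X]mxE mulr_suml; apply: eq_bigr => h _.
by rewrite FG.
Qed.

Lemma Lfun2_suml n (a : 'I_n -> R) (F : 'I_n -> T -> R) :
  (forall i, F i \in L2) -> (fun t => \sum_i a i * F i t) \in L2.
Proof.
move=> FL; apply: Lfun_sum => [|i]; first by rewrite ler1n.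
by apply: LfunZ; rewrite ?ler1n.
Qed.

Hypothesis hP : atomless P.

(** Every event of positive mass contains one of strictly smaller positive mass; the successive
    differences along such a decreasing chain are disjoint. *)
Lemma disjoint_pos : exists F : nat -> set T,
  [/\ forall n, measurable (F n), forall n, 0 < pr P (F n) &
      forall m n, m != n -> F m `&` F n = set0].
Proof.
pose good A := measurable A /\ 0 < pr P A.
have /choice[f fP] : forall A, exists B, good A ->
    [/\ good B, B `<=` A & pr P B < pr P A].
  move=> A; have [[mA A0]|nA] := pselect (good A); last by exists A.
  by have [B [mB BA B0 Blt]] := atomless_split hP mA A0; exists B.
pose b n := iter n f setT.
have bgood n : good (b n).
  elim: n => [|n IH]; first by split; rewrite //= pr_setT.
  by have [] := fP _ IH.
have sub n k : b (k + n)%N `<=` b n.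
  elim: k => //= k IH; apply: subset_trans IH.
  by have [] := fP _ (bgood (k + n)%N).
exists (fun n => b n `\` b n.+1); split=> [n|n|].
- by apply: measurableD; have [] := bgood n; have [] := bgood n.+1.
- have [[mS _] S lt] := fP _ (bgood n); have [mb _] := bgood n.
  by rewrite prD// subr_gt0.
suff H m k : (b m `\` b m.+1) `&` (b (k + m.+1)%N `\` b (k + m.+1).+1) = set0.
  move=> m n; rewrite neq_ltn => /orP[] /subnK <-; first exact: H.
  by rewrite setIC; exact: H.
by rewrite -subset0 => t [[_ nb] [bk _]]; apply: nb; exact: sub bk.
Qed.

(* [w] is a combination of [n.+1] indicators of disjoint sets: the [n]
   orthogonality conditions leave a nonzero solution. *)
Lemma orthonormal_ext n (s : nat -> T -> R) : (forall i, s i \in L2) ->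
  exists w, [/\ w \in L2, mean P (fun t => w t * w t) = 1 &
    forall i, (i < n)%N -> mean P (fun t => w t * s i t) = 0].
Proof.
move=> sL; have [F [mF F0 disjF]] := disjoint_pos.
pose f (l : 'I_n.+1) : T -> R := \1_(F l).
have fL l : f l \in L2 by exact: indic_Lfun2.
pose G : 'M[R]_(n.+1, n) := \matrix_(l, i) mean P (fun t => f l t * s i t).
have : kermx G != 0.
  by rewrite kermx_eq0 /row_free neq_ltn ltnS rank_leq_col.
case/rowV0Pn => u /sub_kermxP uG u0.
pose w t := \sum_l u 0 l * f l t.
have wL : w \in L2 by exact: Lfun2_suml.
have ws i : (i < n)%N -> mean P (fun t => w t * s i t) = 0.
  move=> ltin; rewrite mean_suml//.
  have := congr1 (fun M : 'rV_n => M 0 (Ordinal ltin)) uG; rewrite !mxE => uG0.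
  by rewrite -[RHS]uG0; apply: eq_bigr => l _; rewrite mxE.
have ff l m : mean P (fun t => f l t * f m t) = (l == m)%:R * pr P (F l).
  have [<-|lm] := eqVneq l m.
    rewrite mul1r -mean_indic//; congr mean; apply/funext => t.
    by rewrite /f indicE -natrM mulnbl; case: (_ \in _).
  rewrite mul0r -[RHS](mean_cst P 0); congr mean; apply/funext => t.
  have Flm : F l `&` F m = set0 by exact: disjF.
  rewrite /f !indicE; case: (boolP (t \in F l)) => [|_]; last by rewrite mul0r.
  rewrite inE => Fl; rewrite memNset ?mulr0// => Fm.
  by have : (F l `&` F m) t by []; rewrite Flm.
have ww : mean P (fun t => w t * w t) = \sum_l u 0 l ^+ 2 * pr P (F l).
  rewrite mean_bilinear//; apply: eq_bigr => l _.
  rewrite (bigD1 l)//= big1 ?addr0 => [|m ml].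
    by rewrite ff eqxx mul1r; ring.
  by rewrite ff eq_sym (negbTE ml) mul0r mulr0 mul0r.
(* Disjoint indicators are orthogonal with positive norms, so a nonzero [u] gives a nonzero [w],
   which can be normalized. *)
have c0 : 0 < mean P (fun t => w t * w t).
  rewrite lt_neqAle mean_ge0 ?andbT; last by move=> t; rewrite -expr2 sqr_ge0.
  rewrite eq_sym; apply: contra u0 => /eqP; rewrite ww => /psumr_eq0P h.
  apply/eqP/rowP => l; rewrite mxE; apply/eqP.
  have /h/(_ l isT)/eqP : forall k : 'I_n.+1, true -> 0 <= u 0 k ^+ 2 * pr P (F k).
    by move=> k _; rewrite mulr_ge0 ?sqr_ge0 ?pr_ge0.
  by rewrite mulf_eq0 (gt_eqF (F0 l)) orbF sqrf_eq0.
pose c := Num.sqrt (mean P (fun t => w t * w t)).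
have cE : c ^+ 2 = mean P (fun t => w t * w t) by rewrite sqr_sqrtr// ltW.
exists (fun t => c^-1 * w t); split.
- by apply: LfunZ; rewrite ?ler1n.
- have -> : (fun t => c^-1 * w t * (c^-1 * w t)) = (fun t => c^-1 ^+ 2 * (w t * w t)).
    by apply/funext => t; ring.
  by rewrite meanZ ?Lfun2M// -cE exprVn mulVf// cE gt_eqF.
move=> i ltin; have -> : (fun t => c^-1 * w t * s i t) = (fun t => c^-1 * (w t * s i t)).
  by apply/funext => t; ring.
by rewrite meanZ ?Lfun2M// ws// mulr0.
Qed.

Lemma orthonormal_family n k (s : nat -> T -> R) : (forall i, s i \in L2) ->
  exists w : nat -> T -> R, [/\ forall j, w j \in L2,
    forall i j, (i < k)%N -> (j < k)%N ->
      mean P (fun t => w i t * w j t) = (i == j)%:R &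
    forall i j, (i < n)%N -> (j < k)%N -> mean P (fun t => w j t * s i t) = 0].
Proof.
move=> sL; elim: k => [|k [w [wL ww ws]]].
  (* For [k = 0] only square-integrability is asked of the family, so [s] itself serves. *)
  by exists s; split.
(* The next variable must be orthogonal to the first [n] terms of [s] and to the [k] variables
   already found; the two lists are concatenated. *)
pose s' i := if (i < n)%N then s i else w (i - n)%N.
have s'L i : s' i \in L2 by rewrite /s'; case: ifP.
have [v [vL vv vs]] := orthonormal_ext (n + k) s'L.
have vsn i : (i < n)%N -> mean P (fun t => v t * s i t) = 0.
  by move=> lin; have := vs i; rewrite /s' lin; apply; rewrite ltn_addr.
have vw i : (i < k)%N -> mean P (fun t => v t * w i t) = 0.
  move=> lik; have := vs (n + i)%N.
  rewrite /s' [(n + i < n)%N]ltnNge leq_addr/= addKn; apply.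
  by rewrite ltn_add2l.
exists (fun j => if (j < k)%N then w j else v); split=> [j|i j|i j lin].
- by case: ifP.
- rewrite !ltnS => ik jk; case: (ltnP i k) => ltik; case: (ltnP j k) => ltjk.
  + exact: ww.
  + have -> : (i == j) = false by apply/negbTE; lia.
    by under eq_fun do rewrite mulrC; exact: vw.
  + have -> : (i == j) = false by apply/negbTE; lia.
    exact: vw.
  + have -> : (i == j) by lia.
    exact: vv.
- by rewrite ltnS => jk; case: ltnP => ltjk; [exact: ws | exact: vsn].
Qed.

End orthonormal.

(** * Linear images of standardized vectors with uniform marginals *)

Section uniform_image.
Context (disp : measure_display) (T : measurableType disp) (R : realType)
  (P : probability T R).
Local Notation L2 := (Lfun P 2%:E).
Local Notation s3 := (Num.sqrt (3 : R)).

Lemma sqrt3_gt0 : 0 < s3. Proof. by rewrite sqrtr_gt0. Qed.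

Lemma sqrt3M : s3 * s3 = 3.
Proof. by rewrite -expr2 sqr_sqrtr. Qed.

Lemma mulmx_colE m n (M : 'M[R]_(m, n)) f i :
  (M *m \col_j f j) i 0 = \sum_j M i j * f j.
Proof. by rewrite mxE; apply: eq_bigr => j _; rewrite mxE. Qed.

Lemma mulmx_rvE d k (A : 'M[R]_(d, k)) (V : 'I_k -> {RV P >-> R}) i :
  mulmx_rv P A V i = fun t => \sum_j A i j * V j t.
Proof. by apply/funext => t; exact: mulmx_colE. Qed.

(** The mean being 0, the diagonal covariance equation says that the square has integral 1, whence
    square-integrability. *)
Lemma standardizedP k (V : 'I_k -> {RV P >-> R}) : standardized P V <->
  [/\ forall j, (V j : T -> R) \in L2, forall j, mean P (V j) = 0 &
      forall i j, mean P (fun t => V i t * V j t) = (1%:M : 'M[R]_k) i j].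
Proof.
split=> [[V0 VV]|[VL V0 VV]].
  have mV j : mean P (V j) = 0 by rewrite /mean V0.
  have VL j : (V j : T -> R) \in L2.
    apply: Lfun2_sqr => //; have := VV j j; rewrite !mxE eqxx unlock V0/=.
    rewrite unlock (eq_integral (fun t => (V j t ^+ 2)%:E)) => [->|t _].
      exact: ltry.
    by rewrite -[LHS]/(((V j t - 0) * (V j t - 0))%:E) subr0 expr2.
  split=> // i j; have := VV i j; rewrite covarianceE_mean// !mV mulr0 subr0.
  by case.
split=> [j|i j]; first by rewrite meanE ?V0//; exact: Lfun2_Lfun1.
by rewrite covarianceE_mean// !V0 mulr0 subr0 VV.
Qed.

(** Since [V] is orthonormal, the components of [A V] have second moments [A *m A^T]; an affine map
    carries them to variables uniform on [0, 1]. *)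
Lemma uniform_image_gram d k (A : 'M[R]_(d, k)) (V : 'I_k -> {RV P >-> R}) :
  standardized P V ->
  (forall i, uniform_rv P (ltNsqrt3 R) (mulmx_rv P A V i)) ->
  uniform_gram P d (A *m A^T).
Proof.
move=> /standardizedP[VL V0 VV] uX; have s0 := sqrt3_gt0; have ss := sqrt3M.
pose X i : {RV P >-> R} := mulmx_rv P A V i.
have XE i : (X i : T -> R) = fun t => \sum_j A i j * V j t := mulmx_rvE A V i.
have XL i : (X i : T -> R) \in L2 by rewrite XE; exact: Lfun2_suml.
have X0 i : mean P (X i) = 0.
  rewrite XE mean_sum => [|j]; last by apply: LfunZ => //; exact: Lfun2_Lfun1.
  by apply: big1 => j _; rewrite meanZ ?V0 ?mulr0//; exact: Lfun2_Lfun1.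
have XX i j : mean P (fun t => X i t * X j t) = (A *m A^T) i j.
  by rewrite !XE (mean_gram A VL VV) mulmx1.
have Xcdf i x : - s3 <= x <= s3 -> pr P [set t | X i t <= x] = (x + s3) / (2 * s3).
  move=> xs; have /uniform_rvP := uX i; move/(_ x xs); rewrite opprK => ->.
  by congr (_ / _); ring.
pose Y i t := 2^-1 + (2 * s3)^-1 * X i t.
have YL i : Y i \in L2.
  apply: LfunD; rewrite ?ler1n//; first exact: Lfun_cst.
  by apply: LfunZ; rewrite ?ler1n.
(* [Y i] lies in [0, 1] only almost surely; clipping brings every value inside. *)
pose Z i t := Num.max 0 (Num.min (Y i t) 1).
have mZ i : measurable_fun setT (Z i).
  apply: measurable_maxr => //; apply: measurable_minr => //.
  exact: Lfun2_measurable.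
have YX i x t : (Y i t <= x) = (X i t <= s3 * (2 * x - 1)).
  have -> : X i t = (2 * s3) * (Y i t - 2^-1).
    by rewrite /Y; field; rewrite gt_eqF.
  have -> : s3 * (2 * x - 1) = (2 * s3) * (x - 2^-1) by field.
  by rewrite ler_pM2l ?lerD2r//; lra.
have Ycdf i x : 0 <= x <= 1 -> pr P [set t | Y i t <= x] = x.
  move=> x01; under eq_set do rewrite YX.
  rewrite Xcdf; last by apply/andP; split; nra.
  by field; rewrite gt_eqF.
have uZ i : unif01 P (Z i).
  split=> // [t|x /andP[x0 x1]].
    by rewrite le_max lexx/= ge_max ler01 ge_min lexx orbT.
  (* At [x = 1] the events for [Z i] and [Y i] may differ, because the clipped variable never
     exceeds 1. *)
  have [x_lt1|x_ge1] := ltP x 1.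
    rewrite -[RHS](Ycdf i) ?x0//; congr pr; apply/seteqP; split=> t /=.
      by rewrite /Z ge_max x0/= ge_min (leNgt 1 x) x_lt1 orbF.
    by rewrite /Z ge_max x0/= ge_min => ->.
  have -> : x = 1 by apply/le_anti; rewrite x1.
  rewrite (_ : [set t | _] = setT) ?pr_setT//; apply/seteqP; split=> // t _ /=.
  by rewrite /Z ge_max ler01 ge_min lexx orbT.
have YZ i : ae_eq P setT (Z i) (Y i).
  have mY x : measurable [set t | Y i t <= x] by exact/measurable_le/Lfun2_measurable.
  (* Clipping changes [Y i] only inside this set, which is null because the distribution function of
     [Y i] is 0 at 0 and 1 at 1. *)
  exists ([set t | Y i t <= 0] `|` ~` [set t | Y i t <= 1]); split.
  - by apply: measurableU => //; exact: measurableC.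
  - apply: etrans (prE P _) _; first by apply: measurableU => //; exact: measurableC.
    rewrite prU//; last 2 first.
    + exact: measurableC.
    + by rewrite -subset0 => t [/= h]; apply; rewrite (le_trans h).
    by rewrite -setTD prD// pr_setT !Ycdf ?lexx ?ler01// subrr addr0.
  - move=> t /= h; apply: contrapT => nh; apply: h => _.
    rewrite /Z min_l ?max_r//.
      by rewrite leNgt; apply/negP => /ltW h; apply: nh; left.
    by rewrite leNgt; apply/negP => h; apply: nh; right => /=; rewrite leNgt h.
have /choice[Z' Z'E] : forall i, exists U : {RV P >-> R}, U = Z i :> (T -> R).
  by move=> i; exact: mfun_ex.
exists Z'; split=> [i|i j]; first by rewrite Z'E.
rewrite !Z'E.
have mY i' := Lfun2_measurable (YL i').
have -> : mean P (fun t => Z i t * Z j t) = mean P (fun t => Y i t * Y j t).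
  apply: mean_ae; [exact: measurable_funM|exact: measurable_funM|].
  by apply: filterS2 (YZ i) (YZ j) => t + + _; move=> /(_ I)-> /(_ I)->.
have -> : (fun t => Y i t * Y j t) = (fun t => 12^-1 * (X i t * X j t) +
    (2^-1 * (2 * s3)^-1 * X i t + (2^-1 * (2 * s3)^-1 * X j t + 4^-1))).
  apply/funext => t; rewrite /Y.
  have -> : 12^-1 = (2 * s3)^-1 * (2 * s3)^-1 :> R.
    by rewrite -invfM mulrACA ss; congr (_^-1); ring.
  by field; rewrite gt_eqF.
have XL1 l : (X l : T -> R) \in Lfun P 1 by exact: Lfun2_Lfun1.
rewrite meanD ?LfunZ ?LfunD ?LfunZ ?Lfun2M ?Lfun1_cst//.
rewrite meanD ?LfunD ?LfunZ ?Lfun1_cst// meanD ?LfunZ ?Lfun1_cst//.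
by rewrite !meanZ ?Lfun2M// mean_cst !X0 XX; field.
Qed.

Lemma uniform_image_ex d k (A : 'M[R]_(d, k)) : atomless P ->
  uniform_gram P d (A *m A^T) ->
  exists V : 'I_k -> {RV P >-> R}, standardized P V /\
    forall i, uniform_rv P (ltNsqrt3 R) (mulmx_rv P A V i).
Proof.
move=> hP [Z [uZ MZ]]; have s0 := sqrt3_gt0; have ss := sqrt3M.
have [B [ABA BAsym]] := gram_pinv A.
have ZL i : (Z i : T -> R) \in L2 by exact: unif01_Lfun2.
have ZL1 i : (Z i : T -> R) \in Lfun P 1 by exact: Lfun2_Lfun1.
pose U i t := (2 * s3) * Z i t + - s3.
have UL i : U i \in L2.
  apply: LfunD; rewrite ?ler1n//; last exact: Lfun_cst.
  by apply: LfunZ; rewrite ?ler1n.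
have U0 i : mean P (U i) = 0.
  by rewrite meanD ?LfunZ ?Lfun1_cst// meanZ// mean_cst mean_unif01//; field.
have UU i j : mean P (fun t => U i t * U j t) = (A *m A^T) i j.
  have -> : (fun t => U i t * U j t) = (fun t => 12 * (Z i t * Z j t) +
      (- 6 * Z i t + (- 6 * Z j t + 3))).
    apply/funext => t; rewrite /U.
    transitivity (s3 * s3 * ((2 * Z i t - 1) * (2 * Z j t - 1))); first by ring.
    by rewrite ss; ring.
  rewrite meanD ?LfunZ ?LfunD ?LfunZ ?Lfun2M ?Lfun1_cst//.
  rewrite meanD ?LfunD ?LfunZ ?Lfun1_cst// meanD ?LfunZ ?Lfun1_cst//.
  rewrite !meanZ ?Lfun2M// mean_cst (mean_unif01 (uZ i)) (mean_unif01 (uZ j)) MZ.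
  by field.
(* Index 0 carries the constant 1, orthogonality to which means having mean 0; the [U i] follow, and
   1 fills the remaining indices. *)
pose s n : T -> R := if n is n'.+1 then
  (if insub n' is Some i then U i else cst 1) else cst 1.
have sL n : s n \in L2.
  by case: n => [|n]; rewrite /s ?Lfun_cst//; case: insubP => *; rewrite ?Lfun_cst.
have [w [wL ww ws]] := orthonormal_family hP d.+1 k sL.
have w0 (l : 'I_k) : mean P (w l) = 0.
  by rewrite -(ws 0%N l)//; congr mean; apply/funext => t; rewrite /= mulr1.
have wU (l : 'I_k) (i : 'I_d) : mean P (fun t => w l t * U i t) = 0.
  have sE : s i.+1 = U i by rewrite /s/= valK.
  by have := ws i.+1 l; rewrite sE; apply; rewrite ?ltnS.
(* [C] projects onto the kernel of [A], so adding [C W] completes the covariance of [B U] without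
   altering the image under [A]. *)
pose C : 'M[R]_k := 1%:M - B *m A.
pose u i t := \sum_j B i j * U j t.
pose v i t := \sum_(l < k) C i l * w l t.
have uL i : u i \in L2 by exact: Lfun2_suml.
have vL i : v i \in L2 by exact: Lfun2_suml.
have VL i : (fun t => u i t + v i t) \in L2 by apply: LfunD; rewrite ?ler1n.
have /choice[V VE] : forall i, exists X : {RV P >-> R},
    X = (fun t => u i t + v i t) :> (T -> R).
  by move=> i; apply: mfun_ex; exact: Lfun2_measurable.
have uu i j : mean P (fun t => u i t * u j t) = (B *m (A *m A^T) *m B^T) i j.
  exact: mean_gram.
have vv i j : mean P (fun t => v i t * v j t) = (C *m C^T) i j.
  have wG (l m : 'I_k) : mean P (fun t => w l t * w m t) = (1%:M : 'M[R]_k) l m.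
    by rewrite ww// mxE val_eqE.
  have wL' (l : 'I_k) : w l \in L2 by exact: wL.
  by rewrite (mean_gram C wL' wG) mulmx1.
have vu i j : mean P (fun t => v i t * u j t) = 0.
  rewrite mean_bilinear//; apply: big1 => l _; apply: big1 => m _.
  by rewrite wU mulr0 mul0r.
have BAid : B *m A *m (B *m A) = B *m A by rewrite mulmxA -(mulmxA B) -mulmxA ABA.
(* [B *m A] and [C] are complementary orthogonal projections; each equals its product with its
   transpose, and they sum to the identity. *)
have VV : B *m (A *m A^T) *m B^T + C *m C^T = 1%:M.
  have -> : B *m (A *m A^T) *m B^T = B *m A.
    have -> : B *m (A *m A^T) *m B^T = B *m A *m (B *m A)^T.
      by rewrite trmx_mul !mulmxA.
    by rewrite BAsym BAid.
  have -> : C^T = C by rewrite /C linearB /= trmx1 BAsym.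
  rewrite /C mulmxBr mulmx1 mulmxBl mul1mx BAid subrr subr0.
  by rewrite addrC subrK.
exists V; split.
  apply/standardizedP; split=> [i|i|i j]; rewrite ?VE//.
    rewrite meanD; try exact: Lfun2_Lfun1.
    rewrite /u /v !mean_sum; try by move=> l; apply: LfunZ => //; exact: Lfun2_Lfun1.
    by rewrite !big1 ?addr0// => l _; rewrite meanZ ?U0 ?w0 ?mulr0//; exact: Lfun2_Lfun1.
  have -> : (fun t => (u i t + v i t) * (u j t + v j t)) =
      (fun t => u i t * u j t + (v j t * u i t + (v i t * u j t + v i t * v j t))).
    by apply/funext => t; ring.
  rewrite meanD ?LfunD ?Lfun2M// meanD ?LfunD ?Lfun2M// meanD ?Lfun2M//.
  by rewrite !vu !add0r uu vv -VV [RHS]mxE.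
(* [U - A V = E U] has second moments [E *m (A *m A^T) *m E^T], which vanish since [E *m A = 0]; so
   [A V] equals [U] almost surely. *)
move=> i; pose E := 1%:M - A *m B.
have UAV t : U i t - mulmx_rv P A V i t = \sum_j E i j * U j t.
  have -> : U i t = (1%:M *m \col_j U j t) i 0 by rewrite mul1mx mxE.
  rewrite -mulmx_colE.
  have Vt : \col_j V j t = B *m (\col_j U j t) + C *m (\col_(j < k) w j t).
    by apply/colP => j; rewrite mxE VE [RHS]mxE !mulmx_colE.
  have AC : A *m C = 0 by rewrite /C mulmxBr mulmx1 mulmxA ABA subrr.
  rewrite /mulmx_rv Vt mulmxDr !mulmxA AC mul0mx addr0 /E mulmxBl.
  by rewrite [RHS]mxE [X in _ = _ + X]mxE.
have EA : E *m A = 0 by rewrite /E mulmxBl mul1mx ABA subrr.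
have mAV : measurable_fun setT (mulmx_rv P A V i) by exact: measurable_mulmx_rv.
have UAV0 : ae_eq P setT (mulmx_rv P A V i) (U i).
  have DL : (fun t => \sum_j E i j * U j t) \in L2 by exact: Lfun2_suml.
  have : ae_eq P setT (fun t => \sum_j E i j * U j t) (cst 0).
    apply: mean_sqr_eq0 => //; rewrite (mean_gram E UL UU).
    by rewrite mulmxA EA !mul0mx mxE.
  by apply: filterS => t /[apply]; rewrite -UAV => /subr0_eq.
apply/uniform_rvP => x xs; rewrite (pr_le_ae _ _ _ UAV0)//; last first.
  exact: Lfun2_measurable.
have [_ _ PZ] := uZ i.
have -> : [set t | U i t <= x] = [set t | Z i t <= (x + s3) / (2 * s3)].
  apply/seteqP; split=> t /=; rewrite ler_pdivlMr ?mulr_gt0// /U; lra.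
rewrite PZ; first by congr (_ / _); ring.
rewrite divr_ge0 ?ler_pdivrMr ?mulr_gt0//; lra.
Qed.

End uniform_image.

Theorem theorem2p4 (R : realType) (disp : measure_display)
    (T : measurableType disp) (P : probability T R) (hP : atomless P)
    (d : nat) (hd : (0 < d)%N) :
  spearman_set P d = psd_corr_set R d
  <->
  (forall A : 'M[R]_(d, kmax d), unit_row_set R d (kmax d) A ->
     exists V : 'I_(kmax d) -> {RV P >-> R},
       standardized P V
       /\ forall i : 'I_d, uniform_rv P (ltNsqrt3 R) (mulmx_rv P A V i)).
Proof.
rewrite spearman_uniform_gram; split=> [SP A uA|h].
  apply: uniform_image_ex => //; rewrite SP.
  have [AT A0] := psd_gram A; split=> // [x|]; last exact/unit_row_gram.
  by have := A0 x^T; rewrite /quad trmxK.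
apply/seteqP; split; first exact: uniform_gram_psd.
apply: psd_corr_set_ind => [M N t t01|A /h[V [stV uV]]].
  exact: uniform_gram_convex.
exact: uniform_image_gram stV uV.
Qed.
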